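(* Let $A$, $P$, $L$ be as in the context. Define, with infima/suprema taken over all sequences $\{x_n\}\subset D(L)\setminus\{0\}$ such that $x_n/\|x_n\|\rightharpoonup0$ and $Lx_n/\|Lx_n\|\rightharpoonup0$ weakly, $$m_i:=\inf\liminf_{n\to\infty}\mu_i(x_n),\qquad M_i:=\sup\limsup_{n\to\infty}\mu_i(x_n),\qquad i=1,2,$$ (values in $\mathbb R\cup\{\pm\infty\}$). Then $[m_1,M_1]\cup[m_2,M_2]\subseteq\overline{\mathrm{Spu}(A,P,L)}\cup\hat\sigma_{\rm ess}(A)$.
   Context: $A$ is a self-adjoint operator on a separable Hilbert space $\mathfrak H$ with dense domain $D(A)$ (graph norm $\|x\|^2+\|Ax\|^2$), $P$ an orthogonal projector on $\mathfrak H$, and $L:D(L)\subset P\mathfrak H\to(1-P)\mathfrak H$ an injective linear operator such that $D(L)\oplus LD(L)\subset D(A)$ is a core for $A$. It is assumed that $PAP$ is essentially self-adjoint on $D(L)$ and $(1-P)A(1-P)$ is essentially self-adjoint on $LD(L)$. For a finite-dimensional $V\subset D(A)$, $A_{|V}$ is the restriction of $P_VAP_V$ to $V$. For $0\ne x\in D(L)$, $\mu_1(x)\le\mu_2(x)$ are the two eigenvalues of $A_{|\mathrm{span}\{x,Lx\}}$ (the $2\times2$ matrix of $A$ on $x\mathbb C\oplus Lx\,\mathbb C$). $\lambda\in\mathbb R$ is a $(P,L)$-spurious eigenvalue, $\lambda\in\mathrm{Spu}(A,P,L)$, if there exist finite-dimensional subspaces $V_n^+\subset D(L)$, $V_n^+\subset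 V_{n+1}^+$, such that $\bigcup_n(V_n^+\oplus LV_n^+)$ is dense in $D(A)$ for the graph norm, $\lim_n\mathrm{dist}(\lambda,\sigma(A_{|V_n^+\oplus LV_n^+}))=0$, and $\lambda\notin\sigma(A)$. $\hat\sigma_{\rm ess}(A)$ is $\sigma_{\rm ess}(A)$ together with $-\infty$ (resp. $+\infty$) if $\sigma(A)$ is unbounded below (resp. above). Intervals are in the extended real line, $[c,d]=\emptyset$ if $d<c$. *)

(* Defs.v *)
(* classical reals.  A complex separable Hilbert space is encoded
   as a real Hilbert space (real inner product = real part of the complex one)
   equipped with an orthogonal complex structure J (multiplication by i).
   Complex-linear operators are real-linear operators commuting with J. *)
From Stdlib Require Import Reals List.
Open Scope R_scope.

Record HilbertSpace := {
  hs_car :> Type;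
  hs_zero : hs_car;
  hs_add : hs_car -> hs_car -> hs_car;
  hs_scal : R -> hs_car -> hs_car;
  hs_ip : hs_car -> hs_car -> R;
  hs_J : hs_car -> hs_car;
  hs_add_assoc : forall x y z, hs_add x (hs_add y z) = hs_add (hs_add x y) z;
  hs_add_comm : forall x y, hs_add x y = hs_add y x;
  hs_add_zero : forall x, hs_add x hs_zero = x;
  hs_add_opp : forall x, hs_add x (hs_scal (-1) x) = hs_zero;
  hs_scal_assoc : forall a b x, hs_scal a (hs_scal b x) = hs_scal (a * b) x;
  hs_scal_one : forall x, hs_scal 1 x = x;
  hs_scal_distr_l : forall a x y, hs_scal a (hs_add x y) = hs_add (hs_scal a x) (hs_scal a y);
  hs_scal_distr_r : forall a b x, hs_scal (a + b) x = hs_add (hs_scal a x) (hs_scal b x);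
  hs_ip_sym : forall x y, hs_ip x y = hs_ip y x;
  hs_ip_add : forall x y z, hs_ip (hs_add x y) z = hs_ip x z + hs_ip y z;
  hs_ip_scal : forall a x y, hs_ip (hs_scal a x) y = a * hs_ip x y;
  hs_ip_pos : forall x, 0 <= hs_ip x x;
  hs_ip_def : forall x, hs_ip x x = 0 -> x = hs_zero;
  hs_J_add : forall x y, hs_J (hs_add x y) = hs_add (hs_J x) (hs_J y);
  hs_J_scal : forall a x, hs_J (hs_scal a x) = hs_scal a (hs_J x);
  hs_J_J : forall x, hs_J (hs_J x) = hs_scal (-1) x;
  hs_J_ip : forall x y, hs_ip (hs_J x) (hs_J y) = hs_ip x y;
  hs_complete : forall u : nat -> hs_car,
    (forall eps, 0 < eps -> exists N, forall m n, (N <= m)%nat -> (N <= n)%nat ->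
       sqrt (hs_ip (hs_add (u m) (hs_scal (-1) (u n))) (hs_add (u m) (hs_scal (-1) (u n)))) < eps) ->
    exists x, Un_cv (fun n => sqrt (hs_ip (hs_add (u n) (hs_scal (-1) x)) (hs_add (u n) (hs_scal (-1) x)))) 0;
  hs_separable : exists d : nat -> hs_car, forall x eps, 0 < eps ->
    exists n, sqrt (hs_ip (hs_add (d n) (hs_scal (-1) x)) (hs_add (d n) (hs_scal (-1) x))) < eps
}.

Arguments hs_zero {h}.
Arguments hs_add {h}.
Arguments hs_scal {h}.
Arguments hs_ip {h}.
Arguments hs_J {h}.

Definition vsub {H : HilbertSpace} (x y : H) : H := hs_add x (hs_scal (-1) y).
Definition vnorm {H : HilbertSpace} (x : H) : R := sqrt (hs_ip x x).

Definition converges {H : HilbertSpace} (u : nat -> H) (x : H) : Prop :=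
  Un_cv (fun n => vnorm (vsub (u n) x)) 0.

Definition subspace {H : HilbertSpace} (D : H -> Prop) : Prop :=
  D hs_zero /\ (forall x y, D x -> D y -> D (hs_add x y)) /\
  (forall a x, D x -> D (hs_scal a x)) /\ (forall x, D x -> D (hs_J x)).

Definition lin_op {H : HilbertSpace} (D : H -> Prop) (f : H -> H) : Prop :=
  subspace D /\
  (forall x y, D x -> D y -> f (hs_add x y) = hs_add (f x) (f y)) /\
  (forall a x, D x -> f (hs_scal a x) = hs_scal a (f x)) /\
  (forall x, D x -> f (hs_J x) = hs_J (f x)).

Definition dense_in {H : HilbertSpace} (K D : H -> Prop) : Prop :=
  forall x, K x -> forall eps, 0 < eps -> exists y, D y /\ vnorm (vsub y x) < eps.

(** (D,f) is a self-adjoint operator in the Hilbert space K (a closed subspace of H).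
    Adjoint condition with the real inner product is equivalent to the complex one
    for J-commuting operators on J-invariant domains. *)
Definition sa_in {H : HilbertSpace} (K D : H -> Prop) (f : H -> H) : Prop :=
  lin_op D f /\ (forall x, D x -> K x) /\ dense_in K D /\
  (forall x, D x -> K (f x)) /\
  (forall x y, D x -> D y -> hs_ip (f x) y = hs_ip x (f y)) /\
  (forall y z, K y -> K z -> (forall x, D x -> hs_ip (f x) y = hs_ip x z) ->
     D y /\ f y = z).

Definition self_adjoint {H : HilbertSpace} (D : H -> Prop) (f : H -> H) : Prop :=
  sa_in (fun _ => True) D f.

Definition ess_sa_in {H : HilbertSpace} (K D : H -> Prop) (f : H -> H) : Prop :=
  exists (D' : H -> Prop) (f' : H -> H), sa_in K D' f' /\
    forall x y, (D' x /\ f' x = y) <->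
      (exists u : nat -> H, (forall n, D (u n)) /\ converges u x /\
                            converges (fun n => f (u n)) y).

Definition orth_proj {H : HilbertSpace} (P : H -> H) : Prop :=
  (forall x y, P (hs_add x y) = hs_add (P x) (P y)) /\
  (forall a x, P (hs_scal a x) = hs_scal a (P x)) /\
  (forall x, P (hs_J x) = hs_J (P x)) /\
  (forall x, P (P x) = P x) /\
  (forall x y, hs_ip (P x) y = hs_ip x (P y)).

Definition is_core {H : HilbertSpace} (D : H -> Prop) (f : H -> H) (S : H -> Prop) : Prop :=
  (forall w, S w -> D w) /\
  forall y, D y -> forall eps, 0 < eps -> exists w, S w /\
    (vnorm (vsub w y)) ^ 2 + (vnorm (vsub (f w) (f y))) ^ 2 < eps.

Fixpoint in_cspan {H : HilbertSpace} (l : list H) (x : H) : Prop :=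
  match l with
  | nil => x = hs_zero
  | g :: l' => exists a b y, in_cspan l' y /\
       x = hs_add (hs_add (hs_scal a g) (hs_scal b (hs_J g))) y
  end.

(** σ(A_{|V}): eigenvalues of the compression P_V A P_V restricted to V *)
Definition comp_eig {H : HilbertSpace} (V : H -> Prop) (A : H -> H) (lam : R) : Prop :=
  exists v, V v /\ v <> hs_zero /\
    forall w, V w -> hs_ip (vsub (A v) (hs_scal lam v)) w = 0.

Definition in_resolvent {H : HilbertSpace} (D : H -> Prop) (A : H -> H) (lam : R) : Prop :=
  (forall x, D x -> vsub (A x) (hs_scal lam x) = hs_zero -> x = hs_zero) /\
  (forall y, exists x, D x /\ vsub (A x) (hs_scal lam x) = y) /\
  (exists C, forall x, D x -> vnorm x <= C * vnorm (vsub (A x) (hs_scal lam x))).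

Definition in_spectrum {H : HilbertSpace} (D : H -> Prop) (A : H -> H) (lam : R) : Prop :=
  ~ in_resolvent D A lam.

Definition in_ess_spectrum {H : HilbertSpace} (D : H -> Prop) (A : H -> H) (lam : R) : Prop :=
  in_spectrum D A lam /\
  ~ ((exists eps, 0 < eps /\ forall mu, in_spectrum D A mu -> Rabs (mu - lam) < eps -> mu = lam) /\
     (exists l : list H, forall v, D v -> A v = hs_scal lam v -> in_cspan l v)).

Definition spurious {H : HilbertSpace} (DA : H -> Prop) (A : H -> H)
    (DL : H -> Prop) (L : H -> H) (lam : R) : Prop :=
  exists gens : nat -> list H,
    let W n w := exists u v, in_cspan (gens n) u /\ in_cspan (gens n) v /\
                             w = hs_add u (L v) in
    (forall n g, In g (gens n) -> DL g) /\
    (forall n x, in_cspan (gens n) x -> in_cspan (gens (S n)) x) /\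
    (forall y, DA y -> forall eps, 0 < eps -> exists n w, W n w /\
       (vnorm (vsub w y)) ^ 2 + (vnorm (vsub (A w) (A y))) ^ 2 < eps) /\
    (forall eps, 0 < eps -> exists N, forall n, (N <= n)%nat ->
       exists mu, comp_eig (W n) A mu /\ Rabs (lam - mu) < eps) /\
    ~ in_spectrum DA A lam.

(** μ1(x) ≤ μ2(x): eigenvalues of the 2x2 Hermitian matrix [[a, b],[conj b, d]] of A
    in the orthonormal basis x/|x|, Lx/|Lx| of span{x, Lx}; |b|^2 = (Re b)^2 + (Im b)^2 *)
Definition mat_a {H : HilbertSpace} (A L : H -> H) (x : H) : R :=
  hs_ip (A x) x / (vnorm x) ^ 2.
Definition mat_d {H : HilbertSpace} (A L : H -> H) (x : H) : R :=
  hs_ip (A (L x)) (L x) / (vnorm (L x)) ^ 2.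
Definition mat_b2 {H : HilbertSpace} (A L : H -> H) (x : H) : R :=
  ((hs_ip (A x) (L x)) ^ 2 + (hs_ip (A x) (hs_J (L x))) ^ 2) /
  ((vnorm x) ^ 2 * (vnorm (L x)) ^ 2).
Definition mu1 {H : HilbertSpace} (A L : H -> H) (x : H) : R :=
  (mat_a A L x + mat_d A L x) / 2 -
  sqrt (((mat_a A L x - mat_d A L x) / 2) ^ 2 + mat_b2 A L x).
Definition mu2 {H : HilbertSpace} (A L : H -> H) (x : H) : R :=
  (mat_a A L x + mat_d A L x) / 2 +
  sqrt (((mat_a A L x - mat_d A L x) / 2) ^ 2 + mat_b2 A L x).

Definition admissible {H : HilbertSpace} (DL : H -> Prop) (L : H -> H)
    (xs : nat -> H) : Prop :=
  (forall n, DL (xs n) /\ xs n <> hs_zero) /\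
  (forall y, Un_cv (fun n => hs_ip (xs n) y / vnorm (xs n)) 0) /\
  (forall y, Un_cv (fun n => hs_ip (L (xs n)) y / vnorm (L (xs n))) 0).

Inductive Rbar := Fin (r : R) | PInf | MInf.

Definition Rbar_le (x y : Rbar) : Prop :=
  match x, y with
  | MInf, _ => True
  | _, PInf => True
  | Fin a, Fin b => a <= b
  | _, _ => False
  end.

Definition Rbar_is_glb (S : Rbar -> Prop) (m : Rbar) : Prop :=
  (forall y, S y -> Rbar_le m y) /\
  (forall m', (forall y, S y -> Rbar_le m' y) -> Rbar_le m' m).

Definition Rbar_is_lub (S : Rbar -> Prop) (m : Rbar) : Prop :=
  (forall y, S y -> Rbar_le y m) /\
  (forall m', (forall y, S y -> Rbar_le y m') -> Rbar_le m m').

Definition is_liminf (u : nat -> R) (l : Rbar) : Prop :=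
  Rbar_is_lub (fun y => exists N, Rbar_is_glb (fun z => exists n, (N <= n)%nat /\ z = Fin (u n)) y) l.
Definition is_limsup (u : nat -> R) (l : Rbar) : Prop :=
  Rbar_is_glb (fun y => exists N, Rbar_is_lub (fun z => exists n, (N <= n)%nat /\ z = Fin (u n)) y) l.

(** closure (in the extended real line) of Spu(A,P,L) union \hat σ_ess(A) *)
Definition in_target {H : HilbertSpace} (DA : H -> Prop) (A : H -> H)
    (DL : H -> Prop) (L : H -> H) (l : Rbar) : Prop :=
  match l with
  | Fin r => (forall eps, 0 < eps -> exists s, spurious DA A DL L s /\ Rabs (s - r) < eps)
             \/ in_ess_spectrum DA A r
  | MInf => (forall c, exists s, spurious DA A DL L s /\ s < c)
             \/ (forall c, exists s, in_spectrum DA A s /\ s < c)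
  | PInf => (forall c, exists s, spurious DA A DL L s /\ c < s)
             \/ (forall c, exists s, in_spectrum DA A s /\ c < s)
  end.

(* Main.v *)
(** Suppose a finite [l] is neither a limit of spurious eigenvalues nor in the essential spectrum.
   Then for [lam < l] close to [l], some pair space [W(V0) = V0 + L V0] has the property that no
   [A|W(V)] with [V] containing [V0] has [lam] as an eigenvalue. Adjoining one vector [x] to [V]
   produces a 2x2 Schur complement of [A - lam] whose determinant never vanishes; since it is positive
   definite at a vector far along an admissible sequence with [mu1 > lam], it is positive definite for
   every [x]. Hence [A >= lam] up to finitely many functionals, for all [lam < l] near [l].

   On the other hand admissible pairs provide asymptotically weakly null unit vectors [y] with
   [<(A - l) y, y>] bounded above by an arbitrarily small constant. With [R = (A - l + k)^-1] and [v = y - k R y = (A - l) R y], where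
   [k] is given by the spectral gap at [l], one has [<(A - l) v, v> <= <(A - l) y, y> - k |v|^2], so [v]
   is small; but [(A - l)] is bounded below at [R y] modulo a finite-dimensional kernel, which forces
   [|v| >= |y| / 2].

   The case of [mu2] follows by passing to [- A], and infinite [l] from the fact that a spectrum
   bounded above bounds the form of [A] above. *)
Require Import Defs.
From Stdlib Require Import Reals List Lra Lia Classical IndefiniteDescription Cantor.
Open Scope R_scope.

Declare Scope hilbert_scope.
Local Open Scope hilbert_scope.
Local Notation "x +v y" := (hs_add x y) (at level 50, left associativity) : hilbert_scope.
Local Notation "x -v y" := (vsub x y) (at level 50, left associativity) : hilbert_scope.
Local Notation "a *v x" := (hs_scal a x) (at level 40, left associativity) : hilbert_scope.
Local Notation "0v" := (hs_zero) : hilbert_scope.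
Local Notation J := hs_J.
Local Notation ip := hs_ip.

(** * Hilbert space calculus *)

Section Calculus.
Context {H : HilbertSpace}.
Implicit Types x y z w : H.

(** The form is compared with [lam] slightly below [l], not with [l] itself, because [l] may be an
    isolated eigenvalue of finite multiplicity while a spurious eigenvalue must lie in the resolvent
    set. V0 exists because otherwise every finite-dimensional space could be enlarged to one with a
    compression eigenvalue near [lam]; interleaving such enlargements with a countable graph-dense
    part of the core would make [lam] spurious. Positivity is transported because nothing is known
    about the pair of a general [x]. Far along an admissible sequence the pair is almost orthogonal
    to [(A - lam) W(V0)], so its Schur complement differs little from its 2x2 matrix. No spectral
    measure is used, only lower bounds on [|(A - lam) x|], but functional calculus explains the
    choice of [v]. With [s = t - l], it multiplies [y] by [s / (s + k)], and the bound on its form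
    reads [s^3 / (s + k)^2 <= s - k s^2 / (s + k)^2], that is [s (s + k) >= 0]. This fails only
    between [l - k] and [l], inside the gap. Off the kernel [|s| >= 2k], so the factor is at least
    2/3. *)

Lemma ip_zero_l x : ip 0v x = 0.
Proof.
  assert (E : ip (0v +v 0v) x = ip 0v x) by (now rewrite hs_add_zero).
  rewrite hs_ip_add in E; lra.
Qed.

Lemma ip_add_r x y z : ip x (y +v z) = ip x y + ip x z.
Proof. rewrite !(hs_ip_sym _ x); apply hs_ip_add. Qed.

Lemma ip_scal_r a x y : ip x (a *v y) = a * ip x y.
Proof. rewrite !(hs_ip_sym _ x); apply hs_ip_scal. Qed.

Lemma ip_zero_r x : ip x 0v = 0.
Proof. rewrite hs_ip_sym; apply ip_zero_l. Qed.

Lemma ip_sub_l x y z : ip (x -v y) z = ip x z - ip y z.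
Proof. unfold vsub; rewrite hs_ip_add, hs_ip_scal; ring. Qed.

Lemma ip_sub_r x y z : ip x (y -v z) = ip x y - ip x z.
Proof. unfold vsub; rewrite ip_add_r, ip_scal_r; ring. Qed.

Lemma vec_ext x y : (forall w, ip x w = ip y w) -> x = y.
Proof.
  intros E.
  assert (Z : x -v y = 0v).
  { apply hs_ip_def. rewrite ip_sub_l, !E; ring. }
  transitivity ((x -v y) +v y).
  - unfold vsub. rewrite <- hs_add_assoc, (hs_add_comm _ _ y), hs_add_opp, hs_add_zero; auto.
  - rewrite Z, hs_add_comm; apply hs_add_zero.
Qed.

Lemma J_ip_skew x y : ip (J x) y = - ip x (J y).
Proof.
  rewrite <- (hs_J_ip _ x (J y)), hs_J_J, ip_scal_r; ring.
Qed.

Lemma J_zero : J (0v : H) = 0v.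
Proof. apply vec_ext; intro w. now rewrite J_ip_skew, !ip_zero_l, Ropp_0. Qed.

Lemma J_sub x y : J (x -v y) = J x -v J y.
Proof. unfold vsub. now rewrite hs_J_add, hs_J_scal. Qed.

End Calculus.

Hint Rewrite @hs_J_add @J_sub @hs_J_scal @hs_J_J @J_zero @hs_ip_add @ip_add_r @hs_ip_scal
  @ip_scal_r @ip_zero_l @ip_zero_r @ip_sub_l @ip_sub_r : ip.

Ltac ips := autorewrite with ip.
Ltac vext := apply vec_ext; intro; ips; try ring.

Section Norm.
Context {H : HilbertSpace}.
Implicit Types x y z w : H.

Lemma vnorm_ge0 x : 0 <= vnorm x.
Proof. apply sqrt_pos. Qed.

Lemma vnorm_sq x : vnorm x ^ 2 = ip x x.
Proof. apply pow2_sqrt, hs_ip_pos. Qed.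

Lemma vnorm_sq' x : vnorm x * vnorm x = ip x x.
Proof. rewrite <- vnorm_sq; ring. Qed.

Lemma vnorm_le x a : 0 <= a -> ip x x <= a ^ 2 -> vnorm x <= a.
Proof. intros. rewrite <- vnorm_sq in *. pose proof (vnorm_ge0 x). nra. Qed.

Lemma cauchy_schwarz_sq x y : ip x y ^ 2 <= ip x x * ip y y.
Proof.
  pose proof (hs_ip_pos H (ip x x *v y -v ip x y *v x)) as E.
  autorewrite with ip in E. rewrite (hs_ip_sym H y x) in E.
  pose proof (hs_ip_pos H x) as Ex. pose proof (hs_ip_pos H y).
  destruct Ex as [Ex | Ex].
  - assert (0 <= ip x x * (ip x x * ip y y - ip x y ^ 2)) by nra.
    assert (0 <= ip x x * ip y y - ip x y ^ 2); [|lra].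
    apply Rnot_lt_le; intro. nra.
  - symmetry in Ex. apply hs_ip_def in Ex. subst. ips. nra.
Qed.

Lemma cauchy_schwarz x y : Rabs (ip x y) <= vnorm x * vnorm y.
Proof.
  pose proof (cauchy_schwarz_sq x y). rewrite <- !vnorm_sq in H0.
  pose proof (vnorm_ge0 x); pose proof (vnorm_ge0 y).
  apply Rsqr_incr_0_var; [|nra].
  rewrite <- Rsqr_abs; unfold Rsqr; nra.
Qed.

Lemma vnorm_zero : vnorm (0v : H) = 0.
Proof. unfold vnorm. rewrite ip_zero_l. apply sqrt_0. Qed.

Lemma vnorm_eq0 x : vnorm x = 0 -> x = 0v.
Proof. intro E. apply hs_ip_def. rewrite <- vnorm_sq, E; ring. Qed.

Lemma vnorm_gt0 x : x <> 0v -> 0 < vnorm x.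
Proof.
  intros N. destruct (vnorm_ge0 x) as [|E]; auto.
  exfalso; apply N, vnorm_eq0; auto.
Qed.

Lemma vnorm_scal a x : vnorm (a *v x) = Rabs a * vnorm x.
Proof.
  unfold vnorm. ips. rewrite <- Rmult_assoc, sqrt_mult;
    [|apply Rle_0_sqr|apply hs_ip_pos].
  now rewrite <- sqrt_Rsqr_abs.
Qed.

Lemma vnorm_triang x y : vnorm (x +v y) <= vnorm x + vnorm y.
Proof.
  pose proof (vnorm_ge0 x); pose proof (vnorm_ge0 y).
  apply vnorm_le; [lra|]. ips. rewrite (hs_ip_sym H y x).
  pose proof (cauchy_schwarz x y). pose proof (Rle_abs (ip x y)).
  pose proof (vnorm_sq' x); pose proof (vnorm_sq' y). nra.
Qed.

Lemma vnorm_sub_sym x y : vnorm (x -v y) = vnorm (y -v x).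
Proof. unfold vnorm. f_equal. ips. ring. Qed.

Lemma vnorm_triang_sub x y z : vnorm (x -v z) <= vnorm (x -v y) + vnorm (y -v z).
Proof. replace (x -v z) with ((x -v y) +v (y -v z)) by vext. apply vnorm_triang. Qed.

Lemma vnorm_sub_le x y : vnorm (x -v y) <= vnorm x + vnorm y.
Proof.
  replace (x -v y) with (x +v (-1) *v y) by vext.
  eapply Rle_trans; [apply vnorm_triang|]. rewrite vnorm_scal, Rabs_left; lra.
Qed.

Lemma vnorm_le_sub x y : vnorm x <= vnorm (x -v y) + vnorm y.
Proof. replace x with ((x -v y) +v y) at 1 by vext. apply vnorm_triang. Qed.

Lemma vsub_self x : x -v x = 0v.
Proof. vext. Qed.

Lemma vsub_eq0 x y : x -v y = 0v -> x = y.
Proof. intro E. replace x with ((x -v y) +v y) by vext. rewrite E. vext. Qed.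

End Norm.

Lemma inv_INR_lt eps : 0 < eps -> exists N, forall n, (N <= n)%nat -> / (INR n + 1) < eps.
Proof.
  intros E. destruct (archimed_cor1 eps E) as [N [HN N0]].
  exists N; intros n Hn. apply Rle_lt_trans with (2 := HN).
  apply Rinv_le_contravar; [apply lt_0_INR; lia|].
  apply le_INR in Hn; lra.
Qed.

Lemma inv_INR_pos n : 0 < / (INR n + 1).
Proof. apply Rinv_0_lt_compat. pose proof (pos_INR n); lra. Qed.

(** Stands in for passage to the limit: later estimates carry a free factor [eps] times a fixed
    bound [b], which may vanish. *)
Lemma le_of_le_eps_mul a b : 0 <= b -> (forall eps, 0 < eps -> a <= eps * b) -> a <= 0.
Proof.
  intros Hb Ha. apply Rnot_lt_le; intro Hc.
  assert (0 < a / (2 * (b + 1))) as E by (apply Rdiv_lt_0_compat; lra).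
  specialize (Ha _ E).
  assert (a / (2 * (b + 1)) * b <= a / 2); [|lra].
  replace (a / 2) with (a / (2 * (b + 1)) * (b + 1)) by (field; lra).
  apply Rmult_le_compat_l; lra.
Qed.

(** * Completeness and orthogonal projection *)

Section Completeness.
Context {H : HilbertSpace}.
Implicit Types x y z w : H.

Lemma cauchy_limit (u : nat -> H) (b : nat -> R) :
  (forall eps, 0 < eps -> exists N, forall n, (N <= n)%nat -> b n < eps) ->
  (forall m n, vnorm (u m -v u n) <= b m + b n) ->
  exists x, forall eps, 0 < eps -> exists N, forall n, (N <= n)%nat -> vnorm (u n -v x) < eps.
Proof.
  intros Hb Hu.
  destruct (hs_complete H u) as [x Hx].
  - intros eps He. destruct (Hb (eps / 2)) as [N HN]; [lra|].
    exists N. intros m n Hm Hn. apply Rle_lt_trans with (1 := Hu m n).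
    pose proof (HN m Hm); pose proof (HN n Hn); lra.
  - exists x. intros eps He. destruct (Hx eps He) as [N HN].
    exists N; intros n Hn. specialize (HN n Hn).
    unfold Rdist in HN. rewrite Rminus_0_r, Rabs_pos_eq in HN; [exact HN|apply sqrt_pos].
Qed.

Definition real_subspace (S : H -> Prop) : Prop :=
  S 0v /\ (forall x y, S x -> S y -> S (x +v y)) /\ (forall a x, S x -> S (a *v x)).

Definition in_closure (S : H -> Prop) x : Prop :=
  forall eps, 0 < eps -> exists s, S s /\ vnorm (s -v x) < eps.

(** [S] is not assumed closed, so the projection lies in its closure; this suits the range of
    [A - lam], which is not known to be closed in advance. Orthogonality already holds along a
    minimising sequence, up to an error tending to zero. *)
Lemma projection_theorem (S : H -> Prop) w : real_subspace S ->
  exists r, in_closure S r /\ forall s, S s -> ip (w -v r) s = 0.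
Proof.
  intros (S0 & Sa & Ss).
  (* [completeness] yields suprema, so the infimum of the squared distances is taken as the negative
     of a supremum. *)
  destruct (completeness (fun t => exists s, S s /\ t = - ip (w -v s) (w -v s))) as [d' [Hub Hlub]].
  { exists 0. intros t (s & _ & ->). pose proof (hs_ip_pos H (w -v s)); lra. }
  { exists (- ip (w -v 0v) (w -v 0v)), 0v; auto. }
  set (d := - d').
  assert (Hd : forall s, S s -> d <= ip (w -v s) (w -v s)).
  { intros s Hs. assert (- ip (w -v s) (w -v s) <= d') by (apply Hub; eauto).
    unfold d; lra. }
  assert (Hmin : forall n, exists s, S s /\ ip (w -v s) (w -v s) < d + / (INR n + 1)).
  { intro n. apply NNPP; intro N.
    assert (d' <= d' - / (INR n + 1)).
    { apply Hlub. intros t (s & Hs & ->).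
      apply Rnot_lt_le; intro. apply N. exists s; split; auto. unfold d; lra. }
    pose proof (inv_INR_pos n); lra. }
  apply functional_choice in Hmin. destruct Hmin as [u Hu].
  (* Parallelogram law, with the midpoint of [u m] and [u n] as competitor. *)
  assert (Hpar : forall m n, ip (u m -v u n) (u m -v u n) <= 2 * / (INR m + 1) + 2 * / (INR n + 1)).
  { intros m n. destruct (Hu m) as [Sm Em], (Hu n) as [Sn En].
    assert (Hh := Hd ((1/2) *v (u m +v u n)) ltac:(auto)).
    autorewrite with ip in Hh, Em, En. ips. 
    rewrite (hs_ip_sym H (u m) w), (hs_ip_sym H (u n) w), (hs_ip_sym H (u n) (u m)) in *.
    lra. }
  destruct (cauchy_limit u (fun n => sqrt (2 * / (INR n + 1)))) as [r Hr].
  { intros eps He. destruct (inv_INR_lt (eps ^ 2 / 2)) as [N HN]; [nra|].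
    exists N; intros n Hn. specialize (HN n Hn). pose proof (inv_INR_pos n).
    rewrite <- (sqrt_pow2 eps) by lra. apply sqrt_lt_1; nra. }
  { intros m n. pose proof (inv_INR_pos m); pose proof (inv_INR_pos n).
    apply vnorm_le; [apply Rplus_le_le_0_compat; apply sqrt_pos|].
    pose proof (sqrt_pos (2 * / (INR m + 1))); pose proof (sqrt_pos (2 * / (INR n + 1))).
    assert (A1 := sqrt_sqrt (2 * / (INR m + 1)) ltac:(lra)).
    assert (A2 := sqrt_sqrt (2 * / (INR n + 1)) ltac:(lra)).
    pose proof (Hpar m n). nra. }
  exists r. split.
  - intros eps He. destruct (Hr eps He) as [N HN]. exists (u N). split; [apply Hu|auto].
  - intros s Hs.
    assert (Hn : forall n, Rabs (ip (w -v u n) s) <= sqrt (/ (INR n + 1)) * vnorm s).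
    { intro n. destruct (Hu n) as [Sn En]. set (c := ip (w -v u n) s).
      pose proof (inv_INR_pos n) as Hp.
      (* The best move along [s] lowers the squared distance by [c ^ 2 / ip s s], which cannot
         exceed the excess of [u n] over the infimum. *)
      assert (Hc : c ^ 2 <= / (INR n + 1) * ip s s).
      { destruct (hs_ip_pos H s) as [Pp | P0].
        - assert (Hh := Hd (u n +v (c / ip s s) *v s) ltac:(auto)).
          replace (ip (w -v (u n +v (c / ip s s) *v s)) (w -v (u n +v (c / ip s s) *v s)))
            with (ip (w -v u n) (w -v u n) - c ^ 2 / ip s s) in Hh.
          + assert (c ^ 2 / ip s s <= / (INR n + 1)) by lra.
            apply Rmult_le_compat_r with (r := ip s s) in H0; [|lra].
            unfold Rdiv in H0. rewrite Rmult_assoc, Rinv_l in H0 by lra. lra.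
          + replace (w -v (u n +v (c / ip s s) *v s)) with ((w -v u n) -v (c / ip s s) *v s) by vext.
            set (v := w -v u n) in *. ips. rewrite (hs_ip_sym H s v). fold c. field. lra.
        - symmetry in P0. apply hs_ip_def in P0. unfold c. subst s. ips. nra. }
      rewrite <- vnorm_sq in Hc.
      pose proof (vnorm_ge0 s). pose proof (sqrt_pos (/ (INR n + 1))).
      apply Rsqr_incr_0_var; [|nra]. rewrite <- Rsqr_abs. unfold Rsqr.
      pose proof (sqrt_sqrt (/ (INR n + 1)) ltac:(lra)).
      replace (sqrt (/ (INR n + 1)) * vnorm s * (sqrt (/ (INR n + 1)) * vnorm s))
        with ((sqrt (/ (INR n + 1)) * sqrt (/ (INR n + 1))) * vnorm s ^ 2) by ring.
      rewrite H2. nra. }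
    assert (Rabs (ip (w -v r) s) <= 0).
    { apply (le_of_le_eps_mul _ (2 * vnorm s)); [pose proof (vnorm_ge0 s); lra|].
      intros eps He. destruct (Hr eps He) as [N1 HN1].
      destruct (inv_INR_lt (eps ^ 2)) as [N2 HN2]; [nra|].
      set (n := max N1 N2). specialize (HN1 n ltac:(lia)). specialize (HN2 n ltac:(lia)).
      replace (w -v r) with ((w -v u n) +v (u n -v r)) by vext.
      rewrite hs_ip_add. eapply Rle_trans; [apply Rabs_triang|].
      pose proof (Hn n). pose proof (cauchy_schwarz (u n -v r) s).
      pose proof (vnorm_ge0 s).
      assert (sqrt (/ (INR n + 1)) <= eps).
      { rewrite <- (sqrt_pow2 eps) by lra. apply sqrt_le_1_alt; lra. }
      nra. }
    pose proof (Rabs_pos (ip (w -v r) s)).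
    destruct (Req_dec (ip (w -v r) s) 0); auto. apply Rabs_pos_lt in H2. lra.
Qed.

End Completeness.

(** * Finite-dimensional linear algebra over symmetric forms *)

Section FiniteDimensional.
Context {H : HilbertSpace}.
Implicit Types (x y z w g p v : H) (l : list H) (S D : H -> Prop).

Fixpoint rspan l x : Prop :=
  match l with
  | nil => x = 0v
  | g :: l' => exists a y, rspan l' y /\ x = a *v g +v y
  end.

Lemma real_subspace_sub S x y : real_subspace S -> S x -> S y -> S (x -v y).
Proof. intros (_ & Sa & Ss) Sx Sy. apply Sa; auto. Qed.

Lemma rspan_subspace l : real_subspace (rspan l).
Proof.
  induction l as [|g l (I0 & Ia & Is)]; simpl; repeat split.
  - intros x y -> ->. vext.
  - intros a x ->. vext.
  - exists 0, 0v. split; auto. vext.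
  - intros x y (a & x' & Hx & ->) (b & y' & Hy & ->).
    exists (a + b), (x' +v y'). split; auto. vext.
  - intros c x (a & x' & Hx & ->). exists (c * a), (c *v x'). split; auto. vext.
Qed.

Lemma rspan_cons_tail g l x : rspan l x -> rspan (g :: l) x.
Proof. exists 0, x; split; auto. vext. Qed.

Lemma rspan_mem l g : In g l -> rspan l g.
Proof.
  induction l as [|h l I]; simpl; [tauto|].
  intros [->|Hg].
  - exists 1, 0v. split; [apply rspan_subspace|vext].
  - exists 0, g. split; auto. vext.
Qed.

Lemma rspan_min l S : real_subspace S -> (forall g, In g l -> S g) -> forall x, rspan l x -> S x.
Proof.
  intros (S0 & Sa & Ss). induction l as [|g l I]; simpl; intros Hl x.
  - intros ->; auto.
  - intros (a & y & Hy & ->). apply Sa; [apply Ss; auto|apply I; auto].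
Qed.

(** With [f = ip w] this is the size of [w] seen through finitely many functionals. Statements
    modulo finite dimension are phrased with it, since admissible sequences make it small. *)
Fixpoint abs_sum (f : H -> R) l : R :=
  match l with nil => 0 | g :: l' => Rabs (f g) + abs_sum f l' end.

Lemma abs_sum_ge0 f l : 0 <= abs_sum f l.
Proof. induction l; simpl; [lra|]. pose proof (Rabs_pos (f a)); lra. Qed.

Lemma abs_sum_scal f c l : abs_sum (fun g => c * f g) l = Rabs c * abs_sum f l.
Proof. induction l as [|g l I]; simpl; [ring|]. rewrite I, Rabs_mult; ring. Qed.

Lemma abs_sum_ext f f' l : (forall g, In g l -> f g = f' g) -> abs_sum f l = abs_sum f' l.
Proof.
  induction l as [|g l I]; simpl; auto. intros E. rewrite (E g), I; auto.
Qed.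

Lemma abs_sum_add f f' l : abs_sum (fun g => f g + f' g) l <= abs_sum f l + abs_sum f' l.
Proof.
  induction l as [|g l I]; simpl; [lra|].
  pose proof (Rabs_triang (f g) (f' g)). lra.
Qed.

Lemma abs_sum_map f (k : H -> H) l : abs_sum f (map k l) = abs_sum (fun g => f (k g)) l.
Proof. induction l as [|g l I]; simpl; auto. now rewrite I. Qed.

Record sym_form D (q : H -> H -> R) : Prop := {
  sf_dom : real_subspace D;
  sf_add : forall x y z, D x -> D y -> D z -> q (x +v y) z = q x z + q y z;
  sf_scal : forall a x y, D x -> D y -> q (a *v x) y = a * q x y;
  sf_sym : forall x y, D x -> D y -> q x y = q y x }.

Lemma ip_sym_form : sym_form (fun _ => True) ip.
Proof.
  split; auto using hs_ip_add, hs_ip_scal, hs_ip_sym. repeat split; auto.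
Qed.

Lemma sf_sub D q (Hq : sym_form D q) x y z : D x -> D y -> D z -> q (x -v y) z = q x z - q y z.
Proof.
  intros. pose proof (sf_dom _ _ Hq) as (D0 & Da & Ds). unfold vsub.
  rewrite (sf_add _ _ Hq), (sf_scal _ _ Hq); auto; ring.
Qed.

Lemma sf_zero D q (Hq : sym_form D q) z : D z -> q 0v z = 0.
Proof.
  intros. replace (0v : H) with (0 *v z) by vext. rewrite (sf_scal _ _ Hq); auto; ring.
Qed.

Lemma sf_add_r D q (Hq : sym_form D q) x y z : D x -> D y -> D z -> q x (y +v z) = q x y + q x z.
Proof.
  intros. pose proof (sf_dom _ _ Hq) as (D0 & Da & Ds).
  rewrite (sf_sym _ _ Hq), (sf_add _ _ Hq), (sf_sym _ _ Hq y), (sf_sym _ _ Hq z); auto.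
Qed.

Lemma sf_scal_r D q (Hq : sym_form D q) a x y : D x -> D y -> q x (a *v y) = a * q x y.
Proof.
  intros. pose proof (sf_dom _ _ Hq) as (D0 & Da & Ds).
  rewrite (sf_sym _ _ Hq), (sf_scal _ _ Hq), (sf_sym _ _ Hq y); auto.
Qed.

Lemma sf_sub_r D q (Hq : sym_form D q) x y z : D x -> D y -> D z -> q x (y -v z) = q x y - q x z.
Proof.
  intros. pose proof (sf_dom _ _ Hq) as (D0 & Da & Ds). unfold vsub.
  rewrite (sf_add_r D q Hq), (sf_scal_r D q Hq); auto; ring.
Qed.

(** Duality without bases or dimension count: either [w] agrees with an element of the span as a
    functional on [S], or some [v] in [S] separates it from the span. In the induction, a [v] that
    separates [w] from the smaller span but not from [g] serves as a pivot. *)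
Lemma span_alternative D q (Hq : sym_form D q) S : real_subspace S -> (forall v, S v -> D v) ->
  forall l, (forall g, In g l -> D g) -> forall w, D w ->
  (exists p, rspan l p /\ forall v, S v -> q (w -v p) v = 0) \/
  (exists v, S v /\ (forall u, rspan l u -> q u v = 0) /\ q w v <> 0).
Proof.
  intros HS SD. pose proof (sf_dom _ _ Hq) as HD. pose proof HD as (D0 & Da & Ds).
  induction l as [|g l I]; intros Hl w Hw.
  - destruct (classic (forall v, S v -> q w v = 0)) as [E|N].
    + left. exists 0v. split; [reflexivity|]. intros v Hv.
      rewrite (sf_sub D q Hq), (sf_zero D q Hq), E; auto; ring.
    + right. apply not_all_ex_not in N. destruct N as [v N]. apply imply_to_and in N.
      destruct N as [Hv Nv]. exists v. repeat split; auto.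
      intros u ->. apply (sf_zero D q Hq); auto.
  - assert (Hg : D g) by (apply Hl; now left).
    assert (Hl' : forall h, In h l -> D h) by (intros; apply Hl; now right).
    assert (HlD : forall u, rspan l u -> D u) by (apply rspan_min; auto).
    destruct (I Hl' w Hw) as [(p & Hp & E) | (v & Hv & Ev & Nv)].
    { left. exists p. split; auto using rspan_cons_tail. }
    destruct (Req_dec (q g v) 0) as [G|G].
    { right. exists v. repeat split; auto. intros u (a & y & Hy & ->).
      rewrite (sf_add _ _ Hq), (sf_scal _ _ Hq), G, Ev; auto; ring. }
    (* The coefficients match: [a] makes [w - a g] orthogonal to [v], the later [c] makes [v' - c v]
       orthogonal to [g], and hence [q w (v' - c v) = q (w - a g) v']. *)
    set (a := q w v / q g v).
    assert (Hw' : D (w -v a *v g)) by (apply real_subspace_sub; auto).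
    destruct (I Hl' _ Hw') as [(p & Hp & E) | (v' & Hv' & Ev' & Nv')].
    { left. exists (a *v g +v p). split; [exists a, p; auto|].
      intros u Hu. rewrite <- (E u Hu). f_equal. vext. }
    right. set (c := q g v' / q g v).
    assert (Hvv : S (v' -v c *v v)) by (apply real_subspace_sub; auto; apply HS; auto).
    assert (Dc : D (c *v v)) by auto.
    exists (v' -v c *v v). repeat split; auto.
    + intros u (b & y & Hy & ->).
      rewrite (sf_add _ _ Hq), (sf_scal _ _ Hq), !(sf_sub_r D q Hq), !(sf_scal_r D q Hq); auto.
      rewrite (Ev y), (Ev' y); auto. unfold c. field. auto.
    + intro Z. apply Nv'. rewrite (sf_sub_r D q Hq), (sf_scal_r D q Hq) in Z; auto.
      rewrite (sf_sub D q Hq), (sf_scal _ _ Hq); auto.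
      unfold a, c in *. transitivity (q w v' - q g v' / q g v * q w v); [field; auto|unfold Rdiv in Z; lra].
Qed.

Definition nondegenerate (q : H -> H -> R) S : Prop :=
  forall v, S v -> (forall u, S u -> q v u = 0) -> v = 0v.

(** Nondegeneracy replaces positivity: a separating vector would annihilate the span and hence
    vanish. Replacing [w] by [w - p] is what forms a Schur complement. *)
Lemma form_projection D q (Hq : sym_form D q) l : (forall g, In g l -> D g) ->
  nondegenerate q (rspan l) -> forall w, D w ->
  exists p, rspan l p /\ forall v, rspan l v -> q (w -v p) v = 0.
Proof.
  intros Hl Hn w Hw.
  assert (HlD : forall u, rspan l u -> D u) by (apply rspan_min; auto; apply Hq).
  destruct (span_alternative D q Hq (rspan l) (rspan_subspace l) HlD l Hl w Hw) as [E|(v & Hv & Ev & Nv)]; auto.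
  exfalso. apply Nv. rewrite (Hn v Hv).
  - rewrite (sf_sym _ _ Hq); auto; [apply (sf_zero D q Hq); auto|apply Hq].
  - intros u Hu. rewrite (sf_sym _ _ Hq); auto.
Qed.

Lemma abs_form_le D q (Hq : sym_form D q) l v : (forall g, In g l -> D g) -> rspan l v ->
  exists C, 0 <= C /\ forall p, D p -> Rabs (q p v) <= C * abs_sum (q p) l.
Proof.
  pose proof (sf_dom _ _ Hq) as HD. revert v. induction l as [|g l I]; intros v Hl Hv.
  - simpl in Hv. subst v. exists 0. split; [lra|]. intros p Hp.
    rewrite (sf_sym _ _ Hq), (sf_zero D q Hq), Rabs_R0; auto; [lra|apply HD].
  - destruct Hv as (a & y & Hy & ->).
    assert (Hg : D g) by (apply Hl; now left).
    assert (Hl' : forall h, In h l -> D h) by (intros; apply Hl; now right).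
    assert (Dy : D y) by (eapply rspan_min; eauto).
    destruct (I y Hl' Hy) as (C & C0 & HC). exists (C + Rabs a).
    pose proof (Rabs_pos a). split; [lra|]. intros p Hp. simpl.
    rewrite (sf_add_r D q Hq), (sf_scal_r D q Hq); auto; [|apply HD; auto].
    eapply Rle_trans; [apply Rabs_triang|]. rewrite Rabs_mult.
    pose proof (HC p Hp). pose proof (Rabs_pos (q p g)). pose proof (abs_sum_ge0 (q p) l). nra.
Qed.

(** Equivalence of norms in finite dimension, without compactness: at each step a vector [v]
    annihilating the shorter span but not [g] isolates the coefficient of [g]. The seminorm [nu] is
    left abstract to allow both the norm and a graph norm. *)
Lemma nondegenerate_bound D q (Hq : sym_form D q) (nu : H -> R) l2 :
  (forall g, In g l2 -> D g) ->
  nu 0v = 0 ->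
  (forall a x y, D x -> D y -> nu (a *v x +v y) <= Rabs a * nu x + nu y) ->
  (forall x, 0 <= nu x) ->
  forall l, (forall g, In g l -> D g) ->
  (forall p, rspan l p -> (forall v, rspan l2 v -> q p v = 0) -> p = 0v) ->
  exists C, 0 <= C /\ forall p, rspan l p -> nu p <= C * abs_sum (q p) l2.
Proof.
  intros Hl2 nu0 nuD nup. pose proof (sf_dom _ _ Hq) as HD. pose proof HD as (D0 & Da & Ds).
  assert (H2D : forall u, rspan l2 u -> D u) by (apply rspan_min; auto).
  induction l as [|g l I]; intros Hl Hinj.
  - exists 0. split; [lra|]. intros p ->. rewrite nu0; lra.
  - assert (Hg : D g) by (apply Hl; now left).
    assert (Hl' : forall h, In h l -> D h) by (intros; apply Hl; now right).
    assert (HlD : forall u, rspan l u -> D u) by (apply rspan_min; auto).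
    destruct I as (C & C0 & HC); auto.
    { intros p Hp. apply Hinj. now apply rspan_cons_tail. }
    destruct (span_alternative D q Hq (rspan l2) (rspan_subspace l2) H2D l Hl' g Hg)
      as [(p' & Hp' & E) | (v & Hv & Ev & Nv)].
    + assert (g = p').
      { apply vsub_eq0, Hinj; auto. exists 1, ((-1) *v p'). split; [apply rspan_subspace; auto|vext]. }
      subst p'. exists C. split; auto. intros p (a & y & Hy & ->). apply HC.
      apply rspan_subspace; auto. apply rspan_subspace; auto.
    + destruct (abs_form_le D q Hq l2 v Hl2 Hv) as (Cv & Cv0 & HCv).
      set (k := Rabs (q g v)). assert (Hk : 0 < k) by (apply Rabs_pos_lt; auto).
      set (G := abs_sum (q g) l2). pose proof (abs_sum_ge0 (q g) l2) as G0. fold G in G0.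
      assert (K0 : 0 <= Cv / k) by (apply Rmult_le_pos; [auto|left; apply Rinv_0_lt_compat; auto]).
      pose proof (nup g).
      exists (Cv / k * nu g + C * (1 + Cv / k * G)). split.
      { assert (0 <= Cv / k * nu g) by nra. assert (0 <= Cv / k * G) by nra. nra. }
      intros p (a & y & Hy & ->).
      assert (Dag : D (a *v g)) by auto. assert (Dy : D y) by auto.
      set (p := a *v g +v y). assert (Dp : D p) by (apply Da; auto).
      set (s := abs_sum (q p) l2). assert (s0 : 0 <= s) by apply abs_sum_ge0.
      assert (Ha : Rabs a <= Cv / k * s).
      { assert (q p v = a * q g v) as Epv.
        { unfold p. rewrite (sf_add _ _ Hq), (sf_scal _ _ Hq), (Ev y); auto; ring. }
        pose proof (HCv p Dp) as B. rewrite Epv, Rabs_mult in B. fold k s in B.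
        apply Rmult_le_reg_r with k; auto. unfold Rdiv.
        replace (Cv * / k * s * k) with (Cv * s) by (field; lra). auto. }
      assert (Hs : abs_sum (q y) l2 <= s + Rabs a * G).
      { rewrite (abs_sum_ext (q y) (fun h => q p h + (- a) * q g h)).
        - eapply Rle_trans; [apply abs_sum_add|]. rewrite abs_sum_scal, Rabs_Ropp.
          fold s G. lra.
        - intros h Hh. unfold p. rewrite (sf_add _ _ Hq), (sf_scal _ _ Hq); auto; ring. }
      pose proof (nuD a g y Hg Dy) as Hnu. fold p in Hnu.
      pose proof (HC y Hy) as HCy. pose proof (Rabs_pos a).
      apply Rle_trans with (Rabs a * nu g + C * (s + Rabs a * G)).
      { assert (C * abs_sum (q y) l2 <= C * (s + Rabs a * G)) by (apply Rmult_le_compat_l; auto). lra. }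
      assert (Rabs a * nu g <= Cv / k * s * nu g) by (apply Rmult_le_compat_r; auto).
      assert (Rabs a * G <= Cv / k * s * G) by (apply Rmult_le_compat_r; auto).
      assert (C * (Rabs a * G) <= C * (Cv / k * s * G)) by (apply Rmult_le_compat_l; auto).
      lra.
Qed.

(** Only the orthogonal projection of [w] onto the span pairs with [e], and the norm of that
    projection is controlled by its pairings with the generators. *)
Lemma rspan_pairing_bound l : exists C, 0 <= C /\
  forall w e, rspan l e -> Rabs (ip w e) <= C * vnorm e * abs_sum (ip w) l.
Proof.
  assert (Hn : nondegenerate ip (rspan l)).
  { intros v Hv E. apply hs_ip_def; auto. }
  destruct (nondegenerate_bound (fun _ => True) ip ip_sym_form vnorm l) with (l := l)
    as (C & C0 & HC); auto using vnorm_zero, vnorm_ge0.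
  { intros a x y _ _. eapply Rle_trans; [apply vnorm_triang|]. rewrite vnorm_scal; lra. }
  exists C. split; auto. intros w e He.
  destruct (form_projection (fun _ => True) ip ip_sym_form l (fun _ _ => I) Hn w I) as (p & Hp & E).
  assert (ip w e = ip p e) as ->. { pose proof (E e He) as Z. autorewrite with ip in Z. lra. }
  eapply Rle_trans; [apply cauchy_schwarz|].
  rewrite (abs_sum_ext (ip w) (ip p)).
  - pose proof (HC p Hp). pose proof (vnorm_ge0 e). nra.
  - intros g Hg. pose proof (E g (rspan_mem l g Hg)) as Z. autorewrite with ip in Z. lra.
Qed.

End FiniteDimensional.

(** * Self-adjoint operators and their resolvent sets *)

Section SelfAdjoint.
Context {H : HilbertSpace} {D : H -> Prop} {A : H -> H} (hA : self_adjoint D A).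
Implicit Types (x y z w v : H) (l : list H).

Lemma sa_subspace : real_subspace D.
Proof. destruct hA as [[(D0 & Da & Ds & _) _] _]. repeat split; auto. Qed.

Lemma sa_dom_J x : D x -> D (J x).
Proof. destruct hA as [[(_ & _ & _ & DJ) _] _]. auto. Qed.

Lemma sa_add x y : D x -> D y -> A (x +v y) = A x +v A y.
Proof. destruct hA as [[_ (Aa & _)] _]. auto. Qed.

Lemma sa_scal a x : D x -> A (a *v x) = a *v A x.
Proof. destruct hA as [[_ (_ & As & _)] _]. auto. Qed.

Lemma sa_J x : D x -> A (J x) = J (A x).
Proof. destruct hA as [[_ (_ & _ & AJ)] _]. auto. Qed.

Lemma sa_sub x y : D x -> D y -> A (x -v y) = A x -v A y.
Proof.
  intros. unfold vsub. rewrite sa_add, sa_scal; auto. apply sa_subspace; auto.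
Qed.

Lemma sa_dom_sub x y : D x -> D y -> D (x -v y).
Proof. apply real_subspace_sub, sa_subspace. Qed.

Lemma sa_sym x y : D x -> D y -> ip (A x) y = ip x (A y).
Proof. destruct hA as (_ & _ & _ & _ & S & _). auto. Qed.

Lemma sa_maximal y z : (forall x, D x -> ip (A x) y = ip x z) -> D y /\ A y = z.
Proof. destruct hA as (_ & _ & _ & _ & _ & M). auto. Qed.

Lemma sa_closed x y :
  (forall eps, 0 < eps -> exists u, D u /\ vnorm (u -v x) < eps /\ vnorm (A u -v y) < eps) ->
  D x /\ A x = y.
Proof.
  intros E. apply sa_maximal. intros z Hz. apply Rminus_diag_uniq.
  assert (Rabs (ip (A z) x - ip z y) <= 0).
  { apply (le_of_le_eps_mul _ (vnorm (A z) + vnorm z)).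
    { pose proof (vnorm_ge0 (A z)); pose proof (vnorm_ge0 z); lra. }
    intros eps He. destruct (E eps He) as (u & Hu & E1 & E2).
    replace (ip (A z) x - ip z y) with (ip z (A u -v y) - ip (A z) (u -v x)).
    2:{ ips. rewrite (sa_sym z u); auto. ring. }
    unfold Rminus. eapply Rle_trans; [apply Rabs_triang|]. rewrite Rabs_Ropp.
    pose proof (cauchy_schwarz z (A u -v y)). pose proof (cauchy_schwarz (A z) (u -v x)).
    pose proof (vnorm_ge0 (A z)); pose proof (vnorm_ge0 z). nra. }
  destruct (Req_dec (ip (A z) x - ip z y) 0) as [|N]; auto.
  apply Rabs_pos_lt in N; lra.
Qed.

Definition shift (lam : R) x : H := A x -v lam *v x.

Lemma shift_add lam x y : D x -> D y -> shift lam (x +v y) = shift lam x +v shift lam y.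
Proof. intros. unfold shift. rewrite sa_add; auto. vext. Qed.

Lemma shift_scal lam a x : D x -> shift lam (a *v x) = a *v shift lam x.
Proof. intros. unfold shift. rewrite sa_scal; auto. vext. Qed.

Lemma shift_sub lam x y : D x -> D y -> shift lam (x -v y) = shift lam x -v shift lam y.
Proof. intros. unfold shift. rewrite sa_sub; auto. vext. Qed.

Lemma shift_shift lam mu x : shift mu x = shift lam x +v (lam - mu) *v x.
Proof. unfold shift. vext. Qed.

Lemma shift_sym lam x y : D x -> D y -> ip (shift lam x) y = ip x (shift lam y).
Proof. intros. unfold shift. ips. rewrite (sa_sym x y); auto. Qed.

Lemma shift_zero lam : shift lam 0v = 0v.
Proof.
  replace (0v : H) with (0 *v (0v : H)) at 1 by vext.
  rewrite shift_scal; [vext|apply sa_subspace].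
Qed.

Lemma shift_sym_form lam : sym_form D (fun x y => ip (shift lam x) y).
Proof.
  split; intros.
  - apply sa_subspace.
  - rewrite shift_add; auto. apply hs_ip_add.
  - rewrite shift_scal; auto. apply hs_ip_scal.
  - rewrite shift_sym, hs_ip_sym; auto.
Qed.

Lemma range_subspace lam : real_subspace (fun y => exists x, D x /\ shift lam x = y).
Proof.
  pose proof sa_subspace as (D0 & Da & Ds). repeat split.
  - exists 0v. auto using shift_zero.
  - intros ? ? (x & Hx & <-) (y & Hy & <-). exists (x +v y). auto using shift_add.
  - intros a ? (x & Hx & <-). exists (a *v x). auto using shift_scal.
Qed.

(** Maximality of the symmetric operator turns a vector orthogonal to the range into an element of
    the domain, hence of the kernel. *)
Lemma range_orthogonal lam v : (forall x, D x -> ip v (shift lam x) = 0) ->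
  D v /\ shift lam v = 0v.
Proof.
  intros E. destruct (sa_maximal v (lam *v v)) as [Dv Av].
  - intros x Hx. specialize (E x Hx). rewrite hs_ip_sym in E. unfold shift in E.
    autorewrite with ip in *. lra.
  - split; auto. unfold shift. rewrite Av. apply vsub_self.
Qed.

(** The orthogonal complement of the range is the kernel, which the bound makes trivial, so the
    range is dense. The bound also makes preimages of a convergent sequence Cauchy, and closedness
    of [A] gives surjectivity. *)
Lemma resolvent_of_lower_bound lam c : 0 < c ->
  (forall x, D x -> c * vnorm x <= vnorm (shift lam x)) -> in_resolvent D A lam.
Proof.
  intros Hc B.
  assert (Binj : forall x, D x -> shift lam x = 0v -> x = 0v).
  { intros x Hx E. apply vnorm_eq0. pose proof (B x Hx). rewrite E, vnorm_zero in H0.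
    pose proof (vnorm_ge0 x). nra. }
  repeat split; auto.
  - intros y.
    destruct (projection_theorem _ y (range_subspace lam)) as (r & Hr & Or).
    destruct (range_orthogonal lam (y -v r)) as [Dv Av]; eauto.
    apply Binj in Av; auto. apply vsub_eq0 in Av. subst r.
    assert (Hn : forall n, exists x, D x /\ vnorm (shift lam x -v y) < c * / (INR n + 1)).
    { intros n. destruct (Hr (c * / (INR n + 1))) as (? & (x & Hx & <-) & E); eauto.
      pose proof (inv_INR_pos n); nra. }
    apply functional_choice in Hn. destruct Hn as [u Hu].
    destruct (cauchy_limit u (fun n => / (INR n + 1))) as [x Hx].
    { apply inv_INR_lt. }
    { intros m n. destruct (Hu m) as [Dm Em], (Hu n) as [Dn En].
      pose proof (B (u m -v u n) (sa_dom_sub _ _ Dm Dn)) as Bmn.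
      rewrite shift_sub in Bmn; auto.
      pose proof (vnorm_triang_sub (shift lam (u m)) y (shift lam (u n))) as Tr.
      rewrite (vnorm_sub_sym y) in Tr.
      apply Rmult_le_reg_l with c; auto. lra. }
    destruct (sa_closed x (y +v lam *v x)) as [Dx Ax].
    { intros eps He. pose proof (Rabs_pos lam) as Hl.
      assert (He' : 0 < eps / (2 * (Rabs lam + 1))) by (apply Rdiv_lt_0_compat; lra).
      destruct (Hx _ He') as [N1 HN1].
      destruct (inv_INR_lt (eps / (2 * c))) as [N2 HN2]; [apply Rdiv_lt_0_compat; lra|].
      set (n := max N1 N2). specialize (HN1 n ltac:(lia)). specialize (HN2 n ltac:(lia)).
      destruct (Hu n) as [Dn En]. pose proof (vnorm_ge0 (u n -v x)) as V0.
      assert (K1 : vnorm (u n -v x) * (Rabs lam + 1) < eps / 2).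
      { apply Rlt_le_trans with (eps / (2 * (Rabs lam + 1)) * (Rabs lam + 1)); [|right; field; lra].
        apply Rmult_lt_compat_r; lra. }
      assert (K2 : c * / (INR n + 1) < eps / 2).
      { replace (eps / 2) with (c * (eps / (2 * c))) by (field; lra).
        apply Rmult_lt_compat_l; auto. }
      exists (u n). split; auto. split; [nra|].
      replace (A (u n) -v (y +v lam *v x)) with ((shift lam (u n) -v y) +v lam *v (u n -v x))
        by (unfold shift; vext).
      eapply Rle_lt_trans; [apply vnorm_triang|]. rewrite vnorm_scal. nra. }
    exists x. split; auto. rewrite Ax. vext.
  - exists (/ c). intros x Hx. fold (shift lam x).
    apply Rmult_le_reg_l with c; auto. rewrite <- Rmult_assoc, Rinv_r, Rmult_1_l; [auto|lra].
Qed.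

Lemma resolvent_lower_bound lam : in_resolvent D A lam ->
  exists c, 0 < c /\ forall x, D x -> c * vnorm x <= vnorm (shift lam x).
Proof.
  intros (_ & _ & C & HC). pose proof (Rabs_pos C). pose proof (Rle_abs C).
  exists (/ (Rabs C + 1)). split; [apply Rinv_0_lt_compat; lra|].
  intros x Hx. specialize (HC x Hx). fold (shift lam x) in HC.
  pose proof (vnorm_ge0 (shift lam x)).
  apply Rmult_le_reg_l with (Rabs C + 1); [lra|].
  rewrite <- Rmult_assoc, Rinv_r, Rmult_1_l by lra. nra.
Qed.

Lemma resolvent_open lam : in_resolvent D A lam ->
  exists eps, 0 < eps /\ forall mu, Rabs (mu - lam) < eps -> in_resolvent D A mu.
Proof.
  intros HR. destruct (resolvent_lower_bound lam HR) as (c & Hc & B).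
  exists (c / 2). split; [lra|]. intros mu Hmu.
  apply resolvent_of_lower_bound with (c / 2); [lra|]. intros x Hx.
  pose proof (B x Hx) as Bx.
  rewrite (shift_shift mu lam) in Bx.
  pose proof (vnorm_triang (shift mu x) ((mu - lam) *v x)) as Tr.
  rewrite vnorm_scal in Tr. pose proof (vnorm_ge0 x). nra.
Qed.

(* With [beta] the norm of [(A - m)^-1], [B = (A - m)^-1] satisfies
   [(B - beta) (B + beta) y = B^2 y - beta^2 y], which is small when [|B y|] is close to [beta |y|];
   so [m + 1/beta] or [m - 1/beta] lies in the spectrum. *)
Lemma resolvent_interval_bound m k : 0 < k ->
  (forall mu, Rabs (mu - m) < k -> in_resolvent D A mu) ->
  forall x, D x -> k * vnorm x <= vnorm (shift m x).
Proof.
  intros Hk HI x0 Hx0. apply Rnot_lt_le; intro N.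
  assert (Rm : in_resolvent D A m) by (apply HI; rewrite Rminus_diag, Rabs_R0; auto).
  destruct (resolvent_lower_bound m Rm) as (c & Hc & B).
  destruct (completeness (fun t => exists x, D x /\ 0 < vnorm (shift m x) /\
              t = vnorm x / vnorm (shift m x))) as [beta [Hub Hlub]].
  { exists (/ c). intros t (x & Hx & P & ->). pose proof (B x Hx).
    apply Rmult_le_reg_r with (vnorm (shift m x)); auto.
    unfold Rdiv. rewrite Rmult_assoc, Rinv_l, Rmult_1_r by lra.
    apply Rmult_le_reg_l with c; auto. rewrite <- Rmult_assoc, Rinv_r; lra. }
  { assert (0 < vnorm x0) by (pose proof (vnorm_ge0 (shift m x0)); pose proof (vnorm_ge0 x0); nra).
    pose proof (B x0 Hx0). exists (vnorm x0 / vnorm (shift m x0)), x0. repeat split; auto. nra. }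
  assert (Hb : forall x, D x -> vnorm x <= beta * vnorm (shift m x)).
  { intros x Hx. destruct (vnorm_ge0 (shift m x)) as [P|Z].
    - assert (vnorm x / vnorm (shift m x) <= beta) by (apply Hub; eauto).
      apply Rmult_le_compat_r with (r := vnorm (shift m x)) in H0; [|lra].
      unfold Rdiv in H0. rewrite Rmult_assoc, Rinv_l in H0; lra.
    - pose proof (B x Hx). rewrite <- Z in *. pose proof (vnorm_ge0 x). nra. }
  (* The supposed violation at [x0] puts [1 / beta] below [k], so both [m + 1 / beta] and
     [m - 1 / beta] are resolvent points. *)
  assert (Hb1 : 1 < k * beta).
  { pose proof (Hb x0 Hx0). pose proof (vnorm_ge0 (shift m x0)). pose proof (vnorm_ge0 x0). nra. }
  assert (b0 : 0 < beta) by nra.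
  assert (kb : / beta < k).
  { apply Rmult_lt_reg_r with beta; auto. rewrite Rinv_l; lra. }
  assert (ib : 0 < / beta) by (apply Rinv_0_lt_compat; auto).
  destruct (resolvent_lower_bound (m + / beta)) as (c1 & Hc1 & B1).
  { apply HI. replace (m + / beta - m) with (/ beta) by ring. rewrite Rabs_pos_eq; lra. }
  destruct (resolvent_lower_bound (m - / beta)) as (c2 & Hc2 & B2).
  { apply HI. replace (m - / beta - m) with (- / beta) by ring. rewrite Rabs_Ropp, Rabs_pos_eq; lra. }
  set (b := / beta) in *. assert (Eb : b * beta = 1) by (unfold b; field; lra).
  set (K := (b * ((b / c1) + 1)) * (b / c2)).
  assert (K0 : 0 < K).
  { unfold K. assert (0 < b / c1) by (apply Rdiv_lt_0_compat; auto).
    assert (0 < b / c2) by (apply Rdiv_lt_0_compat; auto).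
    apply Rmult_lt_0_compat; auto. apply Rmult_lt_0_compat; lra. }
  assert (Key : forall x, D x ->
    vnorm x ^ 2 <= K ^ 2 * (beta ^ 2 * (beta ^ 2 * vnorm (shift m x) ^ 2 - vnorm x ^ 2))).
  { intros x Hx. destruct Rm as (_ & Sur & _). destruct (Sur x) as (z & Hz & Ez).
    fold (shift m z) in Ez. set (y := shift m x).
    pose proof sa_subspace as (D0 & Da & Ds).
    (* With [B = (A - m)^-1]: [x = B y], [z = B^2 y], [w = (B + beta) y], [s = B w] and
       [e = (B^2 - beta^2) y]. The bound at [m + b] controls [w] by [e], the one at [m - b] controls
       [x] by [w]. *)
    set (e := z -v beta ^ 2 *v y). set (s := z +v beta *v x). set (w := x +v beta *v y).
    assert (Ds' : D s) by (apply Da; auto).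
    assert (Es : shift (m + b) s = (- b) *v e).
    { rewrite (shift_shift m). unfold s, e. rewrite shift_add, shift_scal by auto.
      rewrite Ez. fold y. vext. 
      replace (m - (m + b)) with (- b) by ring.
      replace (- b * (ip z w0 - beta ^ 2 * ip y w0))
        with (- b * ip z w0 + (b * beta) * beta * ip y w0) by ring.
      replace (- b * (ip z w0 + beta * ip x w0)) with (- b * ip z w0 - (b * beta) * ip x w0) by ring.
      rewrite Eb. ring. }
    assert (Ew : w = b *v s -v b *v e).
    { unfold w, s, e. vext.
      replace (b * (ip z w0 + beta * ip x w0) - b * (ip z w0 - beta ^ 2 * ip y w0))
        with ((b * beta) * ip x w0 + (b * beta) * beta * ip y w0) by ring.
      rewrite Eb. ring. }
    assert (Ex : shift (m - b) x = b *v w).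
    { rewrite (shift_shift m). fold y. unfold w. vext.
      replace (b * (ip x w0 + beta * ip y w0)) with (b * ip x w0 + (b * beta) * ip y w0) by ring.
      rewrite Eb. ring. }
    assert (I1 : vnorm s <= b / c1 * vnorm e).
    { pose proof (B1 s Ds') as I1. rewrite Es, vnorm_scal, Rabs_Ropp, Rabs_pos_eq in I1 by lra.
      apply Rmult_le_reg_l with c1; auto. unfold Rdiv.
      replace (c1 * (b * / c1 * vnorm e)) with (b * vnorm e) by (field; lra). auto. }
    assert (I2 : vnorm w <= b * ((b / c1) + 1) * vnorm e).
    { rewrite Ew. eapply Rle_trans; [apply vnorm_sub_le|].
      rewrite !vnorm_scal, Rabs_pos_eq by lra.
      assert (b * vnorm s <= b * (b / c1 * vnorm e)) by (apply Rmult_le_compat_l; lra). lra. }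
    assert (I3 : vnorm x <= b / c2 * vnorm w).
    { pose proof (B2 x Hx) as I3. rewrite Ex, vnorm_scal, Rabs_pos_eq in I3 by lra.
      apply Rmult_le_reg_l with c2; auto. unfold Rdiv.
      replace (c2 * (b * / c2 * vnorm w)) with (b * vnorm w) by (field; lra). auto. }
    assert (I4 : vnorm x <= K * vnorm e).
    { unfold K. assert (0 <= b / c2) by (left; apply Rdiv_lt_0_compat; auto).
      eapply Rle_trans; [exact I3|].
      apply Rmult_le_compat_l with (r := b / c2) in I2; auto. lra. }
    assert (I5 : vnorm e ^ 2 <= beta ^ 2 * (beta ^ 2 * vnorm y ^ 2 - vnorm x ^ 2)).
    { assert (Ezy : ip z y = vnorm x ^ 2).
      { unfold y. rewrite <- shift_sym, Ez, vnorm_sq; auto. }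
      assert (vnorm e ^ 2 = vnorm z ^ 2 - 2 * beta ^ 2 * vnorm x ^ 2 + beta ^ 4 * vnorm y ^ 2) as ->.
      { rewrite <- Ezy. rewrite !vnorm_sq. unfold e. ips. rewrite (hs_ip_sym H y z). ring. }
      assert (vnorm z <= beta * vnorm x) as Iz by (rewrite <- Ez; auto).
      pose proof (vnorm_ge0 z).
      assert (vnorm z ^ 2 <= beta ^ 2 * vnorm x ^ 2) by nra. nra. }
    pose proof (vnorm_ge0 x). pose proof (vnorm_ge0 e).
    assert (vnorm x ^ 2 <= K ^ 2 * vnorm e ^ 2) by nra. nra. }
  (* [Key] now reads [(1 + h) |x|^2 <= h beta^2 |(A - m) x|^2], so [th * beta] is a smaller upper
     bound of the ratios than their supremum [beta]. *)
  set (h := K ^ 2 * beta ^ 2).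
  assert (h0 : 0 < h) by (apply Rmult_lt_0_compat; apply pow_lt; auto).
  set (th := sqrt (h / (1 + h))).
  assert (Hth : th ^ 2 * (1 + h) = h).
  { unfold th. rewrite pow2_sqrt; [field; lra|]. left; apply Rdiv_lt_0_compat; lra. }
  assert (th0 : 0 <= th) by apply sqrt_pos.
  assert (th1 : th < 1).
  { apply Rnot_le_lt; intro. assert (1 <= th ^ 2) by nra. nra. }
  assert (beta <= beta * th); [|nra].
  apply Hlub. intros t (x & Hx & P & ->).
  apply Rmult_le_reg_r with (vnorm (shift m x)); auto.
  unfold Rdiv. rewrite Rmult_assoc, Rinv_l, Rmult_1_r by lra.
  pose proof (Key x Hx) as Kx. pose proof (vnorm_ge0 x).
  set (X := vnorm x) in *. set (Y := vnorm (shift m x)) in *.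
  assert (X ^ 2 * (1 + h) <= h * (beta ^ 2 * Y ^ 2)) by (unfold h in *; nra).
  assert (X ^ 2 <= (beta * th * Y) ^ 2).
  { apply Rmult_le_reg_r with (1 + h); [lra|].
    replace ((beta * th * Y) ^ 2 * (1 + h)) with ((th ^ 2 * (1 + h)) * (beta ^ 2 * Y ^ 2)) by ring.
    rewrite Hth. auto. }
  apply Rsqr_incr_0_var; [unfold Rsqr; nra|].
  apply Rmult_le_pos; [apply Rmult_le_pos|]; lra.
Qed.

(** For every [k > 0] the point [c + k] has distance at least [k] from the spectrum. Expanding the
    resulting lower bound gives [2 k <(A - c) x, x> <= |(A - c) x|^2], and [k] may be arbitrarily
    large. *)
Lemma form_le_of_resolvent c : (forall mu, c < mu -> in_resolvent D A mu) ->
  forall x, D x -> ip (A x) x <= c * ip x x.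
Proof.
  intros HR x Hx.
  assert (E : forall k, 0 < k -> 2 * k * ip (shift c x) x <= vnorm (shift c x) ^ 2).
  { intros k Hk.
    assert (I : k * vnorm x <= vnorm (shift (c + k) x)).
    { apply resolvent_interval_bound; auto. intros mu Hmu.
      apply HR. apply Rabs_def2 in Hmu. lra. }
    assert (I2 : (k * vnorm x) ^ 2 <= vnorm (shift (c + k) x) ^ 2).
    { pose proof (vnorm_ge0 x). apply pow_incr. nra. }
    replace ((k * vnorm x) ^ 2) with (k ^ 2 * vnorm x ^ 2) in I2 by ring.
    rewrite (shift_shift c), !vnorm_sq in I2. rewrite vnorm_sq.
    autorewrite with ip in I2. rewrite (hs_ip_sym H x (shift c x)) in I2. nra. }
  assert (ip (shift c x) x <= 0).
  { apply Rnot_lt_le; intro P.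
    pose proof (E ((vnorm (shift c x) ^ 2 + 1) / (2 * ip (shift c x) x))) as Ek.
    pose proof (pow2_ge_0 (vnorm (shift c x))).
    assert (0 < (vnorm (shift c x) ^ 2 + 1) / (2 * ip (shift c x) x)) by (apply Rdiv_lt_0_compat; lra).
    specialize (Ek H1).
    replace (2 * ((vnorm (shift c x) ^ 2 + 1) / (2 * ip (shift c x) x)) * ip (shift c x) x)
      with (vnorm (shift c x) ^ 2 + 1) in Ek by (field; lra). lra. }
  unfold shift in H0. autorewrite with ip in H0. lra.
Qed.

(* On a punctured spectral gap of radius [2k] around [lam] the form of [(A - lam)^-1] on the range
   of [A - lam] is bounded by [1/(2k)]; polarization bounds the inverse itself. *)
Lemma punctured_gap_range_bound lam k : 0 < k ->
  (forall mu, mu <> lam -> Rabs (mu - lam) < 2 * k -> in_resolvent D A mu) ->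
  forall u, D u -> in_closure (fun y => exists x, D x /\ shift lam x = y) u ->
  2 * k * vnorm u <= vnorm (shift lam u).
Proof.
  intros Hk HR.
  (* Expansion of the bounds at [lam + k] and [lam - k], each the centre of an interval of radius
     [k] that omits [lam]. *)
  assert (Q : forall u, D u -> 2 * k * Rabs (ip (shift lam u) u) <= vnorm (shift lam u) ^ 2).
  { intros u Hu.
    assert (I1 : k * vnorm u <= vnorm (shift (lam + k) u)).
    { apply resolvent_interval_bound; auto. intros mu Hmu. apply Rabs_def2 in Hmu.
      apply HR; [lra|]. apply Rabs_def1; lra. }
    assert (I2 : k * vnorm u <= vnorm (shift (lam - k) u)).
    { apply resolvent_interval_bound; auto. intros mu Hmu. apply Rabs_def2 in Hmu.
      apply HR; [lra|]. apply Rabs_def1; lra. }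
    pose proof (vnorm_ge0 u).
    assert (J1 : (k * vnorm u) ^ 2 <= vnorm (shift (lam + k) u) ^ 2) by (apply pow_incr; nra).
    assert (J2 : (k * vnorm u) ^ 2 <= vnorm (shift (lam - k) u) ^ 2) by (apply pow_incr; nra).
    rewrite (shift_shift lam) in J1, J2.
    replace ((k * vnorm u) ^ 2) with (k ^ 2 * vnorm u ^ 2) in J1, J2 by ring.
    rewrite !vnorm_sq in J1, J2. rewrite vnorm_sq.
    autorewrite with ip in J1, J2. rewrite (hs_ip_sym H u (shift lam u)) in J1, J2.
    unfold Rabs. destruct (Rcase_abs _); nra. }
  assert (Pol : forall u v, D u -> D v ->
            4 * k * ip (shift lam u) v <= vnorm (shift lam u) ^ 2 + vnorm (shift lam v) ^ 2).
  { intros u v Hu Hv. pose proof sa_subspace as (D0 & Da & Ds).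
    pose proof (Q (u +v v) (Da _ _ Hu Hv)) as Q1.
    pose proof (Q (u -v v) (sa_dom_sub _ _ Hu Hv)) as Q2.
    rewrite !vnorm_sq in *. rewrite shift_add in Q1 by auto. rewrite shift_sub in Q2 by auto.
    assert (S : ip (shift lam v) u = ip (shift lam u) v) by (rewrite shift_sym, hs_ip_sym; auto).
    pose proof (Rle_abs (ip (shift lam u +v shift lam v) (u +v v))) as A1.
    pose proof (Rle_abs (- ip (shift lam u -v shift lam v) (u -v v))) as A2.
    rewrite Rabs_Ropp in A2.
    autorewrite with ip in *. rewrite S in *.
    rewrite (hs_ip_sym H (shift lam v) (shift lam u)) in *. nra. }
  intros u Hu Hcl. apply Rnot_lt_le; intro N.
  pose proof (vnorm_ge0 (shift lam u)) as T0. set (a := vnorm (shift lam u)) in *.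
  assert (U0 : 0 < vnorm u) by (pose proof (vnorm_ge0 u); apply Rnot_le_lt; intro; nra).
  set (U := vnorm u) in *.
  assert (Bd : forall v, D v -> 2 * k * ip u (shift lam v) <= a * vnorm (shift lam v)).
  { intros v Hv. rewrite <- shift_sym by auto.
    pose proof sa_subspace as (D0 & Da & Ds).
    set (b := vnorm (shift lam v)). assert (b0 : 0 <= b) by apply vnorm_ge0.
    (* Rescaling the pair to [r u] and [v / r] balances the two squares; [s = b / a] is then
       optimal. *)
    assert (Sc : forall s, 0 < s -> 4 * k * ip (shift lam u) v <= s * a ^ 2 + / s * b ^ 2).
    { intros s Hs. set (r := sqrt s). assert (r0 : 0 < r) by (apply sqrt_lt_R0; auto).
      assert (Er : s = r ^ 2) by (unfold r; rewrite pow2_sqrt; lra).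
      pose proof (Pol (r *v u) (/ r *v v) (Ds _ _ Hu) (Ds _ _ Hv)) as P.
      rewrite !shift_scal, !vnorm_scal in P by auto. autorewrite with ip in P.
      assert (0 < / r) by (apply Rinv_0_lt_compat; auto).
      rewrite (Rabs_pos_eq r), (Rabs_pos_eq (/ r)) in P by lra. fold a b in P.
      rewrite Er. replace (/ r ^ 2 * b ^ 2) with ((/ r * b) ^ 2) by (field; lra).
      replace (4 * k * (/ r * (r * ip (shift lam u) v))) with (4 * k * ip (shift lam u) v) in P
        by (field; lra). nra. }
    destruct T0 as [a0 | a0], b0 as [b0 | b0].
    - assert (0 < b / a) as ba by (apply Rdiv_lt_0_compat; auto).
      specialize (Sc _ ba). replace (b / a * a ^ 2 + / (b / a) * b ^ 2) with (2 * (a * b)) in Sc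
        by (field; lra). lra.
    - rewrite <- b0. symmetry in b0. apply vnorm_eq0 in b0.
      rewrite shift_sym, b0, ip_zero_r by auto. lra.
    - rewrite <- a0. symmetry in a0. apply vnorm_eq0 in a0.
      rewrite a0, ip_zero_l. lra.
    - rewrite <- a0. symmetry in a0. apply vnorm_eq0 in a0.
      rewrite a0, ip_zero_l. lra. }
  (* [Bd] is tested with [shift lam v] close to [u], which is possible since [u] lies in the closure
     of the range. *)
  assert (Z : 2 * k * U ^ 2 - a * U <= 0).
  { apply (le_of_le_eps_mul _ (2 * k * U + a)); [nra|]. intros eps He.
    destruct (Hcl eps He) as (? & (v & Hv & <-) & E).
    pose proof (Bd v Hv) as Bv.
    assert (ip u (shift lam v) = U ^ 2 + ip u (shift lam v -v u)) as Ei.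
    { unfold U. rewrite vnorm_sq. ips. ring. }
    pose proof (cauchy_schwarz u (shift lam v -v u)) as CS. fold U in CS.
    pose proof (Rle_abs (- ip u (shift lam v -v u))) as CS'. rewrite Rabs_Ropp in CS'.
    pose proof (vnorm_le_sub (shift lam v) u) as Tr. fold U in Tr.
    rewrite Ei in Bv. pose proof (vnorm_ge0 (shift lam v -v u)) as V0.
    assert (a * vnorm (shift lam v) <= a * (eps + U)) by (apply Rmult_le_compat_l; lra).
    assert (- (U * eps) <= ip u (shift lam v -v u)) by nra. nra. }
  nra.
Qed.

(** Split [w = r + e] with [r] in the closure of the range and [e] in the kernel. The gap bounds
    [r], and [<w, e> = |e|^2] lets the functionals of [l] measure [e]. *)
Lemma isolated_finite_lower_bound lam k l : 0 < k ->
  (forall mu, mu <> lam -> Rabs (mu - lam) < 2 * k -> in_resolvent D A mu) ->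
  (forall v, D v -> A v = lam *v v -> rspan l v) ->
  exists C, 0 <= C /\ forall w, D w ->
    vnorm w <= vnorm (shift lam w) / (2 * k) + C * abs_sum (ip w) l.
Proof.
  intros Hk HR Hker. destruct (rspan_pairing_bound l) as (C & C0 & HC).
  exists C. split; auto. intros w Hw.
  destruct (projection_theorem _ w (range_subspace lam)) as (r & Hr & Or).
  destruct (range_orthogonal lam (w -v r)) as [De Te]; eauto.
  set (e := w -v r) in *.
  assert (Er : r = w -v e) by (unfold e; vext).
  assert (Dr : D r) by (rewrite Er; apply sa_dom_sub; auto).
  assert (Tr : shift lam r = shift lam w) by (rewrite Er, shift_sub, Te by auto; vext).
  pose proof (punctured_gap_range_bound lam k Hk HR r Dr Hr) as B. rewrite Tr in B.
  assert (Ee : rspan l e) by (apply Hker; auto; apply vsub_eq0; auto).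
  assert (O : ip r e = 0).
  { destruct (Req_dec (ip r e) 0) as [|N]; auto. exfalso.
    assert (Rabs (ip r e) <= 0); [|apply Rabs_pos_lt in N; lra].
    apply (le_of_le_eps_mul _ (vnorm e)); [apply vnorm_ge0|]. intros eps He.
    destruct (Hr eps He) as (s & Hs & Es). pose proof (Or s Hs) as Os.
    replace (ip r e) with (- ip (s -v r) e).
    - rewrite Rabs_Ropp. pose proof (cauchy_schwarz (s -v r) e). pose proof (vnorm_ge0 e). nra.
    - ips. rewrite (hs_ip_sym H s e), Os. ring. }
  assert (Ie : vnorm e <= C * abs_sum (ip w) l).
  { pose proof (HC w e Ee) as P. pose proof (vnorm_ge0 e) as e0. pose proof (abs_sum_ge0 (ip w) l).
    assert (ip w e = vnorm e ^ 2) as E1.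
    { rewrite vnorm_sq. replace (ip w e) with (ip e e + ip r e) by (rewrite Er; ips; ring). lra. }
    rewrite E1, Rabs_pos_eq in P by nra. destruct e0 as [e0|e0]; nra. }
  assert (Ir : vnorm r <= vnorm (shift lam w) / (2 * k)).
  { apply Rmult_le_reg_l with (2 * k); [lra|].
    replace (2 * k * (vnorm (shift lam w) / (2 * k))) with (vnorm (shift lam w)) by (field; lra). auto. }
  replace w with (r +v e) at 1 by (rewrite Er; vext).
  pose proof (vnorm_triang r e). lra.
Qed.

End SelfAdjoint.

Arguments shift {H} A lam x.

(** * Hermitian forms on pairs of vectors *)

Section HermitianPairs.
Context {H : HilbertSpace} {D : H -> Prop} {A : H -> H} (hA : self_adjoint D A).
Implicit Types (x y z w v p X Z Y : H) (g : list H).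

(** The complex combination [(a1 + i a2) x + (c1 + i c2) z] in real coordinates. *)
Definition comb (a1 a2 c1 c2 : R) x z : H := (a1 *v x +v a2 *v J x) +v (c1 *v z +v c2 *v J z).

Lemma shift_J lam x : D x -> shift A lam (J x) = J (shift A lam x).
Proof. intros. unfold shift. rewrite (sa_J hA); auto. vext. Qed.

Lemma comb_dom a1 a2 c1 c2 x z : D x -> D z -> D (comb a1 a2 c1 c2 x z).
Proof.
  intros. pose proof (sa_subspace hA) as (D0 & Da & Ds). pose proof (sa_dom_J hA).
  unfold comb. auto 10.
Qed.

Lemma shift_comb lam a1 a2 c1 c2 x z : D x -> D z ->
  shift A lam (comb a1 a2 c1 c2 x z) = comb a1 a2 c1 c2 (shift A lam x) (shift A lam z).
Proof.
  intros. pose proof (sa_subspace hA) as (D0 & Da & Ds). pose proof (sa_dom_J hA).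
  unfold comb. rewrite !(shift_add hA), !(shift_scal hA), !shift_J; auto.
Qed.

(** Determinant of the 2x2 Hermitian matrix of [A - lam] on the pair; the last two squares are those
    of the real and imaginary parts of the off-diagonal entry. *)
Definition herm_det lam X Z : R :=
  ip (shift A lam X) X * ip (shift A lam Z) Z
  - ip (shift A lam X) Z ^ 2 - ip (shift A lam X) (J Z) ^ 2.

Lemma herm_table lam X Z : D X -> D Z ->
  ip (shift A lam X) (J X) = 0 /\
  ip (shift A lam Z) (J Z) = 0 /\
  ip (shift A lam Z) X = ip (shift A lam X) Z /\
  ip (shift A lam Z) (J X) = - ip (shift A lam X) (J Z).
Proof.
  intros HX HZ. pose proof (sa_dom_J hA) as DJ.
  assert (S : forall Y, D Y -> ip (shift A lam Y) (J Y) = 0).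
  { intros Y HY. pose proof (shift_sym hA lam Y (J Y) HY (DJ _ HY)) as E.
    rewrite shift_J, (hs_ip_sym H Y), J_ip_skew in E; auto. lra. }
  repeat split; auto.
  - rewrite (shift_sym hA), hs_ip_sym; auto.
  - rewrite (shift_sym hA), shift_J, hs_ip_sym, J_ip_skew; auto.
Qed.

Lemma herm_expand lam a1 a2 c1 c2 X Z : D X -> D Z ->
  ip (shift A lam (comb a1 a2 c1 c2 X Z)) (comb a1 a2 c1 c2 X Z) =
  (a1 ^ 2 + a2 ^ 2) * ip (shift A lam X) X + (c1 ^ 2 + c2 ^ 2) * ip (shift A lam Z) Z
  + 2 * ((a1 * c1 + a2 * c2) * ip (shift A lam X) Z
         + (a1 * c2 - a2 * c1) * ip (shift A lam X) (J Z)).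
Proof.
  intros HX HZ. rewrite shift_comb; auto. unfold comb. ips. rewrite !J_ip_skew. ips.
  destruct (herm_table lam X Z HX HZ) as (E1 & E2 & E3 & E4). rewrite E1, E2, E3, E4. ring.
Qed.

Lemma herm_complete_square lam a1 a2 c1 c2 X Z : D X -> D Z ->
  let a := ip (shift A lam X) X in
  let b1 := ip (shift A lam X) Z in
  let b2 := ip (shift A lam X) (J Z) in
  a * ip (shift A lam (comb a1 a2 c1 c2 X Z)) (comb a1 a2 c1 c2 X Z) =
  (a * a1 + b1 * c1 + b2 * c2) ^ 2 + (a * a2 + b1 * c2 - b2 * c1) ^ 2
  + herm_det lam X Z * (c1 ^ 2 + c2 ^ 2).
Proof. intros HX HZ a b1 b2. rewrite herm_expand; auto. unfold herm_det. fold a b1 b2. ring. Qed.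

Lemma herm_nonneg lam a1 a2 c1 c2 X Z : D X -> D Z ->
  0 <= ip (shift A lam X) X -> 0 <= ip (shift A lam Z) Z -> 0 <= herm_det lam X Z ->
  0 <= ip (shift A lam (comb a1 a2 c1 c2 X Z)) (comb a1 a2 c1 c2 X Z).
Proof.
  intros HX HZ Ha Hd Hdet. destruct Ha as [Ha|Ha].
  - pose proof (herm_complete_square lam a1 a2 c1 c2 X Z HX HZ) as E. cbv zeta in E.
    set (Q := ip (shift A lam (comb _ _ _ _ _ _)) _) in *.
    pose proof (pow2_ge_0 (ip (shift A lam X) X * a1 + ip (shift A lam X) Z * c1
                           + ip (shift A lam X) (J Z) * c2)).
    pose proof (pow2_ge_0 (ip (shift A lam X) X * a2 + ip (shift A lam X) Z * c2
                           - ip (shift A lam X) (J Z) * c1)).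
    assert (0 <= herm_det lam X Z * (c1 ^ 2 + c2 ^ 2)) by (apply Rmult_le_pos; nra).
    apply Rmult_le_reg_l with (1 := Ha). lra.
  - rewrite herm_expand; auto. unfold herm_det in Hdet. rewrite <- Ha in *.
    assert (ip (shift A lam X) Z = 0) as -> by nra.
    assert (ip (shift A lam X) (J Z) = 0) as -> by nra. nra.
Qed.

Lemma herm_pos_det lam X Z : D X -> D Z ->
  (forall a1 a2 c1 c2, (a1 <> 0 \/ a2 <> 0 \/ c1 <> 0 \/ c2 <> 0) ->
    0 < ip (shift A lam (comb a1 a2 c1 c2 X Z)) (comb a1 a2 c1 c2 X Z)) ->
  0 < ip (shift A lam X) X /\ 0 < herm_det lam X Z.
Proof.
  intros HX HZ Hp. assert (Ha : 0 < ip (shift A lam X) X).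
  { pose proof (Hp 1 0 0 0 ltac:(lra)) as E. rewrite herm_expand in E; auto. lra. }
  split; auto.
  set (a := ip (shift A lam X) X) in *.
  set (b1 := ip (shift A lam X) Z).
  set (b2 := ip (shift A lam X) (J Z)).
  (* These coefficients annihilate both squares in [herm_complete_square], leaving the determinant
     times [a ^ 2]. *)
  pose proof (Hp (- b1) b2 a 0 ltac:(lra)) as E.
  pose proof (herm_complete_square lam (- b1) b2 a 0 X Z HX HZ) as F. cbv zeta in F.
  fold a b1 b2 in F. apply Rmult_lt_compat_l with (r := a) in E; auto. rewrite F in E.
  apply Rmult_lt_reg_r with (a ^ 2 + 0 ^ 2); nra.
Qed.

(** If the first diagonal entry is zero, the off-diagonal one vanishes too and [X] itself is in the
    kernel; otherwise a column of the adjugate matrix works. *)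
Lemma herm_kernel lam X Z : D X -> D Z -> herm_det lam X Z = 0 ->
  exists a1 a2 c1 c2, (a1 <> 0 \/ a2 <> 0 \/ c1 <> 0 \/ c2 <> 0) /\
    forall d1 d2 e1 e2,
      ip (shift A lam (comb a1 a2 c1 c2 X Z)) (comb d1 d2 e1 e2 X Z) = 0.
Proof.
  intros HX HZ E. destruct (herm_table lam X Z HX HZ) as (E1 & E2 & E3 & E4).
  unfold herm_det in E.
  set (a := ip (shift A lam X) X) in *.
  set (b1 := ip (shift A lam X) Z) in *.
  set (b2 := ip (shift A lam X) (J Z)) in *.
  set (d := ip (shift A lam Z) Z) in *.
  destruct (Req_dec a 0) as [Ha|Ha].
  - exists 1, 0, 0, 0. split; [lra|]. intros.
    rewrite shift_comb; auto. unfold comb. ips. rewrite !J_ip_skew. ips.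
    rewrite E1. fold a b1 b2. rewrite Ha in *.
    assert (b1 = 0) as -> by nra. assert (b2 = 0) as -> by nra. ring.
  - exists (- b1), b2, a, 0. split; [lra|]. intros.
    rewrite shift_comb; auto. unfold comb. ips. rewrite !J_ip_skew. ips.
    rewrite E1, E2, E3, E4. fold a b1 b2 d.
    transitivity (e1 * (a * d - b1 ^ 2 - b2 ^ 2)); [ring|rewrite E; ring].
Qed.

End HermitianPairs.

Lemma continuity_ext (f h : R -> R) : (forall t, f t = h t) -> continuity f -> continuity h.
Proof.
  intros E Hf t eps He. destruct (Hf t eps He) as (d & Hd & B). exists d. split; auto.
  intros s Hs. rewrite <- !E. auto.
Qed.

Lemma ivt_positive (f : R -> R) : continuity f -> (forall t, 0 <= t <= 1 -> f t <> 0) ->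
  0 < f 1 -> forall t, 0 <= t <= 1 -> 0 < f t.
Proof.
  intros Hc Hn H1 t Ht. apply Rnot_le_lt; intro N.
  destruct (IVT_cor f t 1 Hc ltac:(lra) ltac:(nra)) as (s & Hs & E).
  apply (Hn s); [lra|auto].
Qed.

(** * Compressions to spans of pairs *)

Section BalancedPairs.
Context {H : HilbertSpace} {D : H -> Prop} {A : H -> H} (hA : self_adjoint D A)
  {P : H -> H} {DL : H -> Prop} {L : H -> H} (hP : orth_proj P) (hL : lin_op DL L)
  (hLP : forall x, DL x -> P x = x) (hLQ : forall x, DL x -> P (L x) = 0v)
  (hLinj : forall x y, DL x -> DL y -> L x = L y -> x = y)
  (hcore : is_core D A (fun w => exists u v, DL u /\ DL v /\ w = hs_add u (L v))).
Implicit Types (x y z w v p u X Z Y : H) (g : list H).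

Lemma DL_subspace : real_subspace DL.
Proof. destruct hL as [(D0 & Da & Ds & _) _]. repeat split; auto. Qed.

Lemma DL_J x : DL x -> DL (J x).
Proof. destruct hL as [(_ & _ & _ & DJ) _]. auto. Qed.

Lemma L_add x y : DL x -> DL y -> L (x +v y) = L x +v L y.
Proof. destruct hL as [_ (La & _)]. auto. Qed.

Lemma L_scal a x : DL x -> L (a *v x) = a *v L x.
Proof. destruct hL as [_ (_ & Ls & _)]. auto. Qed.

Lemma L_J x : DL x -> L (J x) = J (L x).
Proof. destruct hL as [_ (_ & _ & LJ)]. auto. Qed.

Lemma L_zero : L 0v = 0v.
Proof.
  replace (0v : H) with (0 *v (0v : H)) at 1 by vext.
  rewrite L_scal; [vext|apply DL_subspace].
Qed.

Lemma DL_dom x : DL x -> D x.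
Proof.
  intros Hx. apply (proj1 hcore). exists x, 0v. rewrite L_zero.
  repeat split; auto; [apply DL_subspace|vext].
Qed.

Lemma L_dom x : DL x -> D (L x).
Proof.
  intros Hx. apply (proj1 hcore). exists 0v, x.
  repeat split; auto; [apply DL_subspace|vext].
Qed.

Lemma pair_orthogonal x y : DL x -> DL y -> ip x (L y) = 0.
Proof.
  intros Hx Hy. destruct hP as (_ & _ & _ & _ & Ps).
  rewrite <- (hLP x Hx), Ps, hLQ, ip_zero_r; auto.
Qed.

Lemma L_nonzero x : DL x -> x <> 0v -> L x <> 0v.
Proof.
  intros Hx N E. apply N, hLinj; auto; [apply DL_subspace|]. now rewrite L_zero.
Qed.

Definition all_DL g : Prop := forall x, In x g -> DL x.

Lemma cspan_subspace g : real_subspace (in_cspan g).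
Proof.
  induction g as [|h g (I0 & Ia & Is)]; simpl; repeat split.
  - intros x y -> ->. vext.
  - intros a x ->. vext.
  - exists 0, 0, 0v. split; auto. vext.
  - intros x y (a & b & x' & Hx & ->) (c & d & y' & Hy & ->).
    exists (a + c), (b + d), (x' +v y'). split; auto. vext.
  - intros c x (a & b & x' & Hx & ->). exists (c * a), (c * b), (c *v x'). split; auto. vext.
Qed.

Lemma cspan_J g x : in_cspan g x -> in_cspan g (J x).
Proof.
  revert x. induction g as [|h g I]; simpl; intros x.
  - intros ->. apply J_zero.
  - intros (a & b & y & Hy & ->). exists (- b), a, (J y). split; auto. vext.
Qed.

Lemma cspan_cons_tail h g x : in_cspan g x -> in_cspan (h :: g) x.
Proof. exists 0, 0, x. split; auto. vext. Qed.

Lemma cspan_cons_head h g : in_cspan (h :: g) h.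
Proof. exists 1, 0, 0v. split; [apply cspan_subspace|vext]. Qed.

Lemma cspan_min g (S : H -> Prop) : real_subspace S -> (forall x, S x -> S (J x)) ->
  (forall x, In x g -> S x) -> forall x, in_cspan g x -> S x.
Proof.
  intros (S0 & Sa & Ss) SJ. induction g as [|h g I]; simpl; intros Hg x.
  - intros ->; auto.
  - intros (a & b & y & Hy & ->). apply Sa; [apply Sa; apply Ss; auto|apply I; auto].
Qed.

Lemma cspan_DL g x : all_DL g -> in_cspan g x -> DL x.
Proof. intros Hg. apply cspan_min; auto using DL_subspace, DL_J. Qed.

(** Agrees with the space [W n] of [spurious] when [g] is [gens n]. *)
Definition pair_span g w : Prop :=
  exists u v, in_cspan g u /\ in_cspan g v /\ w = u +v L v.

Lemma pair_span_subspace g : all_DL g -> real_subspace (pair_span g).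
Proof.
  intros Hg. destruct (cspan_subspace g) as (C0 & Ca & Cs). repeat split.
  - exists 0v, 0v. rewrite L_zero. repeat split; auto. vext.
  - intros x y (u & v & Hu & Hv & ->) (u' & v' & Hu' & Hv' & ->).
    exists (u +v u'), (v +v v'). repeat split; auto.
    rewrite L_add; [vext|apply (cspan_DL g); auto|apply (cspan_DL g); auto].
  - intros a x (u & v & Hu & Hv & ->). exists (a *v u), (a *v v). repeat split; auto.
    rewrite L_scal; [vext|apply (cspan_DL g); auto].
Qed.

Lemma pair_span_J g w : all_DL g -> pair_span g w -> pair_span g (J w).
Proof.
  intros Hg (u & v & Hu & Hv & ->). exists (J u), (J v).
  repeat split; auto using cspan_J. rewrite L_J; [vext|apply (cspan_DL g); auto].
Qed.

Lemma pair_span_cspan g u : in_cspan g u -> pair_span g u.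
Proof. intros. exists u, 0v. rewrite L_zero. repeat split; auto; [apply cspan_subspace|vext]. Qed.

Lemma pair_span_L g u : in_cspan g u -> pair_span g (L u).
Proof. intros. exists 0v, u. repeat split; auto; [apply cspan_subspace|vext]. Qed.

Lemma pair_span_dom g w : all_DL g -> pair_span g w -> D w.
Proof.
  intros Hg (u & v & Hu & Hv & ->). pose proof (sa_subspace hA) as (D0 & Da & Ds).
  apply Da; [apply DL_dom|apply L_dom]; apply (cspan_DL g); auto.
Qed.

Lemma pair_span_mono g g' w : (forall x, in_cspan g x -> in_cspan g' x) ->
  pair_span g w -> pair_span g' w.
Proof. intros Hs (u & v & Hu & Hv & ->). exists u, v; auto. Qed.

Lemma pair_span_comb g a1 a2 c1 c2 x z : all_DL g -> pair_span g x -> pair_span g z ->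
  pair_span g (comb a1 a2 c1 c2 x z).
Proof.
  intros Hg Hx Hz. destruct (pair_span_subspace g Hg) as (S0 & Sa & Ss).
  unfold comb. auto 10 using pair_span_J.
Qed.

Lemma pair_span_cons x g w : all_DL g -> DL x -> pair_span (x :: g) w ->
  exists v a1 a2 c1 c2, pair_span g v /\ w = v +v comb a1 a2 c1 c2 x (L x).
Proof.
  intros Hg Hx (u & v & (a1 & a2 & u' & Hu & ->) & (c1 & c2 & v' & Hv & ->) & ->).
  exists (u' +v L v'), a1, a2, c1, c2. split; [exists u', v'; auto|].
  pose proof DL_subspace as (D0 & Da & Ds). pose proof DL_J.
  assert (DL v') by (apply (cspan_DL g); auto).
  rewrite !L_add, !L_scal, L_J; auto. unfold comb. vext.
Qed.

(** Four real generators per vector bring the complex pair space within reach of the real linear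
    algebra on [rspan]. *)
Fixpoint real_gens g : list H :=
  match g with
  | nil => nil
  | x :: g' => x :: J x :: L x :: J (L x) :: real_gens g'
  end.

Lemma real_gens_dom g : all_DL g -> forall h, In h (real_gens g) -> D h.
Proof.
  induction g as [|x g I]; simpl; intros Hg h; [tauto|].
  assert (DL x) by (apply Hg; now left).
  assert (all_DL g) by (intros y Hy; apply Hg; now right).
  pose proof (sa_dom_J hA). intros [<-|[<-|[<-|[<-|Hh]]]]; auto using DL_dom, L_dom.
Qed.

Lemma real_gens_span g w : all_DL g -> (rspan (real_gens g) w <-> pair_span g w).
Proof.
  revert w. induction g as [|x g I]; intros w Hg.
  - simpl. split.
    + intros ->. apply pair_span_subspace; auto.
    + intros (u & v & -> & -> & ->). rewrite L_zero. vext.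
  - assert (Hx : DL x) by (apply Hg; now left).
    assert (Hg' : all_DL g) by (intros y Hy; apply Hg; now right).
    split.
    + simpl. intros (a1 & ? & (a2 & ? & (c1 & ? & (c2 & v & Hv & ->) & ->) & ->) & ->).
      apply I in Hv; auto.
      destruct (pair_span_subspace _ Hg) as (S0 & Sa & Ss).
      assert (pair_span (x :: g) x) by (apply pair_span_cspan, cspan_cons_head).
      assert (pair_span (x :: g) (L x)) by (apply pair_span_L, cspan_cons_head).
      assert (pair_span (x :: g) v).
      { revert Hv. apply pair_span_mono, cspan_cons_tail. }
      pose proof (pair_span_J (x :: g)). auto 10.
    + intros Hw. apply pair_span_cons in Hw; auto.
      destruct Hw as (v & a1 & a2 & c1 & c2 & Hv & ->). apply I in Hv; auto.
      simpl. exists a1, (a2 *v J x +v (c1 *v L x +v (c2 *v J (L x) +v v))). split.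
      2:{ unfold comb. vext. }
      exists a2, (c1 *v L x +v (c2 *v J (L x) +v v)). split; auto.
      exists c1, (c2 *v J (L x) +v v). split; auto. exists c2, v. auto.
Qed.


(** A vector annihilated by the form on the whole pair space would be an eigenvector of the
    compression; its absence is the condition needed for [form_projection]. *)
Lemma pair_nondegenerate lam g : ~ comp_eig (pair_span g) A lam ->
  nondegenerate (fun x y => ip (shift A lam x) y) (pair_span g).
Proof.
  intros N v Hv E. apply NNPP; intro Z. apply N. exists v. auto.
Qed.

Lemma pair_projection lam g w : all_DL g -> ~ comp_eig (pair_span g) A lam -> D w ->
  exists p, pair_span g p /\ forall v, pair_span g v -> ip (shift A lam (w -v p)) v = 0.
Proof.
  intros Hg N Hw.
  assert (Nd : nondegenerate (fun x y => ip (shift A lam x) y) (rspan (real_gens g))).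
  { intros v Hv E. apply (pair_nondegenerate lam g N); [apply real_gens_span; auto|].
    intros u Hu. apply E, real_gens_span; auto. }
  destruct (form_projection D _ (shift_sym_form hA lam) (real_gens g) (real_gens_dom g Hg) Nd w Hw)
    as (p & Hp & E).
  exists p. split; [apply real_gens_span; auto|]. intros v Hv. apply E, real_gens_span; auto.
Qed.

(** * Schur complements of adjoined pairs *)

Lemma comb_sub a1 a2 c1 c2 x z p q :
  comb a1 a2 c1 c2 x z -v comb a1 a2 c1 c2 p q = comb a1 a2 c1 c2 (x -v p) (z -v q).
Proof. unfold comb. vext. Qed.

Lemma comb_orthogonal lam g a1 a2 c1 c2 X Z : all_DL g -> D X -> D Z ->
  (forall v, pair_span g v -> ip (shift A lam X) v = 0) ->
  (forall v, pair_span g v -> ip (shift A lam Z) v = 0) ->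
  forall v, pair_span g v -> ip (shift A lam (comb a1 a2 c1 c2 X Z)) v = 0.
Proof.
  intros Hg HX HZ EX EZ v Hv. rewrite (shift_comb hA); auto. unfold comb. ips.
  rewrite !J_ip_skew, !EX, !EZ; auto using pair_span_J. ring.
Qed.

Lemma cspan_divide g a b x : (a <> 0 \/ b <> 0) -> in_cspan g (a *v x +v b *v J x) -> in_cspan g x.
Proof.
  intros Hab Hu. destruct (cspan_subspace g) as (C0 & Ca & Cs).
  assert (N : a ^ 2 + b ^ 2 <> 0) by (destruct Hab; nra).
  set (u := a *v x +v b *v J x) in *.
  replace x with ((/ (a ^ 2 + b ^ 2)) *v (a *v u +v (- b) *v J u)).
  - auto using cspan_J.
  - unfold u. vext. field. auto.
Qed.

(** Separating the components along [P] and [1 - P] gives [s = L t], which is orthogonal to itself;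
    injectivity of [L] then gives [t = 0]. Since some coefficient is nonzero, a complex division
    places [x] in the span. *)
Lemma comb_independent g a1 a2 c1 c2 x : all_DL g -> DL x -> ~ in_cspan g x ->
  (a1 <> 0 \/ a2 <> 0 \/ c1 <> 0 \/ c2 <> 0) -> ~ pair_span g (comb a1 a2 c1 c2 x (L x)).
Proof.
  intros Hg Hx Nx Hc (u & v & Hu & Hv & E).
  pose proof DL_subspace as HD. pose proof HD as (D0 & Da & Ds). pose proof DL_J.
  assert (DL u) by (apply (cspan_DL g); auto). assert (DL v) by (apply (cspan_DL g); auto).
  set (s := (a1 *v x +v a2 *v J x) -v u). set (t := v -v (c1 *v x +v c2 *v J x)).
  assert (Hs : DL s) by (apply real_subspace_sub; auto).
  assert (Ht : DL t) by (apply real_subspace_sub; auto).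
  assert (Est : s = L t).
  { unfold s, t, vsub. rewrite !L_add, !L_scal, !L_add, !L_scal, L_J; auto.
    unfold comb in E. apply vsub_eq0. apply (f_equal (fun y => y -v (u +v L v))) in E.
    rewrite vsub_self in E. rewrite <- E. vext. }
  assert (s = 0v) as Es by (apply hs_ip_def; rewrite Est at 2; apply pair_orthogonal; auto).
  assert (t = 0v) as Et by (apply NNPP; intro N; apply (L_nonzero t Ht N); congruence).
  apply vsub_eq0 in Es, Et. apply Nx.
  destruct (classic (a1 <> 0 \/ a2 <> 0)).
  - apply (cspan_divide g a1 a2); auto. congruence.
  - apply (cspan_divide g c1 c2); [lra|]. congruence.
Qed.

(* The determinant of the Schur complement on the pair [x_t, L x_t] cannot vanish along the segment
   from [x] to [x'], so positivity at [x'] is transported to [x]. *)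
Lemma schur_step lam g x x' : all_DL g -> DL x -> DL x' ->
  (forall g', all_DL g' -> (forall u, in_cspan g u -> in_cspan g' u) ->
     ~ comp_eig (pair_span g') A lam) ->
  ~ in_cspan (x :: g) x' ->
  (forall p q, pair_span g p -> pair_span g q ->
     (forall v, pair_span g v -> ip (shift A lam (x' -v p)) v = 0) ->
     (forall v, pair_span g v -> ip (shift A lam (L x' -v q)) v = 0) ->
     0 < ip (shift A lam (x' -v p)) (x' -v p) /\ 0 < herm_det (A := A) lam (x' -v p) (L x' -v q)) ->
  forall w, pair_span (x :: g) w -> exists p, pair_span g p /\
    (forall v, pair_span g v -> ip (shift A lam (w -v p)) v = 0) /\
    0 <= ip (shift A lam (w -v p)) (w -v p).
Proof.
  intros Hg Hx Hx' Hne Nx' Hpos w Hw.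
  pose proof (pair_span_subspace g Hg) as HS. pose proof HS as (S0 & Sa & Ss).
  pose proof (pair_span_dom g) as SD.
  (* If [x] already lies in the span, nothing is adjoined and [p = w] serves. *)
  destruct (classic (in_cspan g x)) as [Cx|Cx].
  { assert (Hw' : pair_span g w).
    { revert Hw. apply pair_span_mono. intros u (a & b & y & Hy & ->).
      destruct (cspan_subspace g) as (C0 & Ca & Cs). auto 10 using cspan_J. }
    exists w. rewrite vsub_self, (shift_zero hA). repeat split; auto; intros; rewrite ip_zero_l; lra. }
  pose proof (Hne g Hg (fun _ h => h)) as Nc.
  destruct (pair_projection lam g x Hg Nc (DL_dom x Hx)) as (p0 & Hp0 & O1).
  destruct (pair_projection lam g (L x) Hg Nc (L_dom x Hx)) as (q0 & Hq0 & O2).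
  destruct (pair_projection lam g x' Hg Nc (DL_dom x' Hx')) as (p1 & Hp1 & O3).
  destruct (pair_projection lam g (L x') Hg Nc (L_dom x' Hx')) as (q1 & Hq1 & O4).
  destruct (Hpos p1 q1) as [Pa Pd]; auto.
  set (X := x -v p0) in *. set (Z := L x -v q0) in *.
  set (X' := x' -v p1) in *. set (Z' := L x' -v q1) in *.
  assert (DX : D X) by (apply (sa_dom_sub hA); auto using DL_dom).
  assert (DZ : D Z) by (apply (sa_dom_sub hA); auto using L_dom).
  assert (DX' : D X') by (apply (sa_dom_sub hA); auto using DL_dom).
  assert (DZ' : D Z') by (apply (sa_dom_sub hA); auto using L_dom).
  pose proof (sa_subspace hA) as (D0 & Da & Ds). pose proof DL_subspace as (L0 & La & Ls).
  (* The projections are interpolated together with the vectors, so [Xt t] and [Zt t] stay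
     form-orthogonal to [pair_span g] and all matrix entries are polynomials in [t]. *)
  set (Xt := fun t => (1 - t) *v X +v t *v X').
  set (Zt := fun t => (1 - t) *v Z +v t *v Z').
  set (xt := fun t => (1 - t) *v x +v t *v x').
  assert (DXt : forall t, D (Xt t)) by (intro; unfold Xt; auto).
  assert (DZt : forall t, D (Zt t)) by (intro; unfold Zt; auto).
  assert (Dxt : forall t, DL (xt t)) by (intro; unfold xt; auto).
  set (pt := fun t => (1 - t) *v p0 +v t *v p1).
  set (qt := fun t => (1 - t) *v q0 +v t *v q1).
  assert (EXt : forall t, Xt t = xt t -v pt t).
  { intro t. unfold Xt, xt, pt, X, X'. vext. }
  assert (EZt : forall t, Zt t = L (xt t) -v qt t).
  { intro t. unfold Zt, xt, qt, Z, Z'. rewrite L_add, !L_scal; auto. vext. }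
  assert (OX : forall t v, pair_span g v -> ip (shift A lam (Xt t)) v = 0).
  { intros t v Hv. unfold Xt. rewrite (shift_add hA), !(shift_scal hA); auto. ips.
    rewrite O1, O3; auto; ring. }
  assert (OZ : forall t v, pair_span g v -> ip (shift A lam (Zt t)) v = 0).
  { intros t v Hv. unfold Zt. rewrite (shift_add hA), !(shift_scal hA); auto. ips.
    rewrite O2, O4; auto; ring. }
  (* At [t = 0] this is the case assumption on [x]; for [t > 0], membership would place [x'] in the
     span of [x] and [g]. *)
  assert (Nxt : forall t, 0 <= t <= 1 -> ~ in_cspan g (xt t)).
  { intros t Ht C. destruct (Req_dec t 0) as [->|Nt].
    - apply Cx. replace x with (xt 0) by (unfold xt; vext). auto.
    - apply Nx'. exists (- (1 - t) / t), 0, ((/ t) *v xt t).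
      split; [apply cspan_subspace; auto|]. unfold xt. vext. field; auto. }
  (* A kernel vector of the degenerate Schur complement is orthogonal to all of [pair_span g'] and
     nonzero by independence, so it would make [lam] an eigenvalue of that compression. *)
  assert (Ndet : forall t, 0 <= t <= 1 -> herm_det (A := A) lam (Xt t) (Zt t) <> 0).
  { intros t Ht E.
    destruct (herm_kernel hA lam (Xt t) (Zt t) (DXt t) (DZt t) E)
      as (a1 & a2 & c1 & c2 & Nz & Ker).
    set (g' := xt t :: g).
    assert (Hg' : all_DL g') by (intros y [<-|Hy]; auto).
    assert (Sub : forall u, in_cspan g u -> in_cspan g' u) by apply cspan_cons_tail.
    apply (Hne g' Hg' Sub).
    pose proof (pair_span_subspace g' Hg') as HS'.
    assert (Mono : forall v, pair_span g v -> pair_span g' v) by (intro; apply pair_span_mono; auto).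
    assert (Hpt : pair_span g (pt t)) by (unfold pt; auto).
    assert (Hqt : pair_span g (qt t)) by (unfold qt; auto).
    assert (HXt : pair_span g' (Xt t)).
    { rewrite EXt. apply real_subspace_sub; auto. apply pair_span_cspan, cspan_cons_head. }
    assert (HZt : pair_span g' (Zt t)).
    { rewrite EZt. apply real_subspace_sub; auto. apply pair_span_L, cspan_cons_head. }
    exists (comb a1 a2 c1 c2 (Xt t) (Zt t)). split; [apply pair_span_comb; auto|]. split.
    - intro Z0. apply (comb_independent g a1 a2 c1 c2 (xt t)); auto.
      replace (comb a1 a2 c1 c2 (xt t) (L (xt t))) with (comb a1 a2 c1 c2 (pt t) (qt t)).
      + apply pair_span_comb; auto.
      + symmetry. apply vsub_eq0. rewrite comb_sub, <- EXt, <- EZt. auto.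
    - intros v Hv. fold (shift A lam (comb a1 a2 c1 c2 (Xt t) (Zt t))).
      destruct (pair_span_cons (xt t) g v Hg (Dxt t) Hv) as (v0 & d1 & d2 & e1 & e2 & Hv0 & ->).
      replace (comb d1 d2 e1 e2 (xt t) (L (xt t)))
        with (comb d1 d2 e1 e2 (Xt t) (Zt t) +v comb d1 d2 e1 e2 (pt t) (qt t)).
      2:{ rewrite EXt, EZt. unfold comb. vext. }
      rewrite !ip_add_r, Ker.
      rewrite !(comb_orthogonal lam g); auto using pair_span_comb; ring. }
  assert (EvX : Xt 1 = X') by (unfold Xt; vext). assert (EvZ : Zt 1 = Z') by (unfold Zt; vext).
  assert (Ca : continuity (fun t => ip (shift A lam (Xt t)) (Xt t))).
  { assert (forall t, ip (shift A lam (Xt t)) (Xt t) =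
        (1 - t) * (1 - t) * ip (shift A lam X) X + (1 - t) * t * ip (shift A lam X) X'
        + t * (1 - t) * ip (shift A lam X') X + t * t * ip (shift A lam X') X') as E.
    { intro t. unfold Xt. rewrite (shift_add hA), !(shift_scal hA); auto. ips. ring. }
    eapply continuity_ext; [intro; symmetry; apply E|]. reg. }
  assert (Cd : continuity (fun t => herm_det (A := A) lam (Xt t) (Zt t))).
  { assert (forall t U U' V V', D U -> D U' ->
        ip (shift A lam ((1 - t) *v U +v t *v U')) ((1 - t) *v V +v t *v V') =
        (1 - t) * (1 - t) * ip (shift A lam U) V + (1 - t) * t * ip (shift A lam U) V'
        + t * (1 - t) * ip (shift A lam U') V + t * t * ip (shift A lam U') V') as E.
    { intros. rewrite (shift_add hA), !(shift_scal hA); auto. ips. ring. }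
    eapply continuity_ext.
    { intro s. symmetry. unfold herm_det.
      replace (J (Zt s)) with ((1 - s) *v J Z +v s *v J Z') by (unfold Zt; vext).
      unfold Xt, Zt.
      rewrite (E s X X' X X'), (E s Z Z' Z Z'), (E s X X' Z Z'), (E s X X' (J Z) (J Z'));
        auto. reflexivity. }
    reg. }
  assert (Pdet : forall t, 0 <= t <= 1 -> 0 < herm_det (A := A) lam (Xt t) (Zt t)).
  { apply ivt_positive; auto. rewrite EvX, EvZ. auto. }
  (* A positive determinant forbids a zero diagonal entry, so the diagonal entry keeps its sign as
     well. *)
  assert (Pa0 : 0 < ip (shift A lam (Xt 0)) (Xt 0)).
  { apply (ivt_positive (fun t => ip (shift A lam (Xt t)) (Xt t))); [auto| | |lra].
    - intros t Ht E. pose proof (Pdet t Ht) as F. unfold herm_det in F. rewrite E in F. nra.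
    - rewrite EvX; auto. }
  specialize (Pdet 0 ltac:(lra)).
  replace (Xt 0) with X in * by (unfold Xt; vext).
  replace (Zt 0) with Z in * by (unfold Zt; vext).
  destruct (pair_span_cons x g w Hg Hx Hw) as (v0 & a1 & a2 & c1 & c2 & Hv0 & ->).
  exists (v0 +v comb a1 a2 c1 c2 p0 q0).
  split; [apply Sa; auto; apply pair_span_comb; auto|].
  replace ((v0 +v comb a1 a2 c1 c2 x (L x)) -v (v0 +v comb a1 a2 c1 c2 p0 q0))
    with (comb a1 a2 c1 c2 X Z) by (unfold X, Z, comb; vext).
  split.
  - apply comb_orthogonal; auto.
  - pose proof (herm_complete_square hA lam a1 a2 c1 c2 X Z DX DZ) as E. cbv zeta in E.
    apply Rmult_le_reg_l with (1 := Pa0). rewrite E, Rmult_0_r.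
    apply Rplus_le_le_0_compat; [apply Rplus_le_le_0_compat; apply pow2_ge_0|].
    apply Rmult_le_pos; [lra|]. apply Rplus_le_le_0_compat; apply pow2_ge_0.
Qed.

(** * Estimates on pairs along admissible sequences *)

Lemma comb_norm a1 a2 c1 c2 x : DL x ->
  ip (comb a1 a2 c1 c2 x (L x)) (comb a1 a2 c1 c2 x (L x)) =
  (a1 ^ 2 + a2 ^ 2) * ip x x + (c1 ^ 2 + c2 ^ 2) * ip (L x) (L x).
Proof.
  intros Hx. pose proof (DL_J x Hx) as HJ.
  assert (S : forall z : H, ip (J z) z = 0).
  { intro z. pose proof (J_ip_skew z z) as E. rewrite (hs_ip_sym H z) in E. lra. }
  pose proof (pair_orthogonal x x Hx Hx) as O1.
  pose proof (pair_orthogonal x (J x) Hx HJ) as O2. rewrite L_J in O2 by auto.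
  unfold comb. ips. rewrite !hs_J_ip, !(hs_ip_sym H x (J x)), !S,
    !(hs_ip_sym H (L x) (J (L x))), !S, !(hs_ip_sym H (L x) x), !J_ip_skew,
    !(hs_ip_sym H (L x) (J x)), !J_ip_skew, O1, O2. ring.
Qed.

(** The bound is uniform in the coefficients: by orthogonality each coefficient times the norm of
    its vector is at most the norm of the combination, and there are four real terms. *)
Lemma comb_pairing a1 a2 c1 c2 x z e : DL x -> 0 <= e ->
  Rabs (ip x z) <= e * vnorm x -> Rabs (ip x (J z)) <= e * vnorm x ->
  Rabs (ip (L x) z) <= e * vnorm (L x) -> Rabs (ip (L x) (J z)) <= e * vnorm (L x) ->
  Rabs (ip (comb a1 a2 c1 c2 x (L x)) z) <= 4 * e * vnorm (comb a1 a2 c1 c2 x (L x)).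
Proof.
  intros Hx e0 E1 E2 E3 E4. set (y := comb a1 a2 c1 c2 x (L x)).
  pose proof (comb_norm a1 a2 c1 c2 x Hx) as N. fold y in N. rewrite <- !vnorm_sq in N.
  pose proof (vnorm_ge0 y) as y0. pose proof (vnorm_ge0 x) as x0. pose proof (vnorm_ge0 (L x)) as l0.
  assert (B : forall a n, 0 <= n -> a ^ 2 * n ^ 2 <= vnorm y ^ 2 -> Rabs a * n <= vnorm y).
  { intros a n n0 Ha. pose proof (Rabs_pos a). rewrite <- (pow2_abs a) in Ha.
    apply Rsqr_incr_0_var; auto. unfold Rsqr. nra. }
  set (X := vnorm x) in *. set (Y := vnorm (L x)) in *.
  assert (Q : forall a n, 0 <= a ^ 2 * n ^ 2) by (intros; apply Rmult_le_pos; apply pow2_ge_0).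
  pose proof (Q a1 X); pose proof (Q a2 X); pose proof (Q c1 Y); pose proof (Q c2 Y).
  assert (B1 : Rabs a1 * X <= vnorm y) by (apply B; lra).
  assert (B2 : Rabs a2 * X <= vnorm y) by (apply B; lra).
  assert (B3 : Rabs c1 * Y <= vnorm y) by (apply B; lra).
  assert (B4 : Rabs c2 * Y <= vnorm y) by (apply B; lra).
  assert (M : forall a n t, 0 <= n -> Rabs a * n <= vnorm y -> Rabs t <= e * n ->
             Rabs (a * t) <= e * vnorm y).
  { intros a n t n0 Ha Ht. rewrite Rabs_mult. pose proof (Rabs_pos a). pose proof (Rabs_pos t).
    assert (Rabs a * Rabs t <= Rabs a * (e * n)) by (apply Rmult_le_compat_l; auto).
    apply Rmult_le_compat_l with (r := e) in Ha; auto. lra. }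
  unfold y at 1. unfold comb. ips. rewrite !J_ip_skew.
  pose proof (M a1 X _ x0 B1 E1). pose proof (M a2 X _ x0 B2 E2).
  pose proof (M c1 Y _ l0 B3 E3). pose proof (M c2 Y _ l0 B4 E4).
  replace (a1 * ip x z + a2 * - ip x (J z) + (c1 * ip (L x) z + c2 * - ip (L x) (J z)))
    with ((a1 * ip x z + - (a2 * ip x (J z))) + (c1 * ip (L x) z + - (c2 * ip (L x) (J z)))) by ring.
  eapply Rle_trans; [apply Rabs_triang|].
  pose proof (Rabs_triang (a1 * ip x z) (- (a2 * ip x (J z)))) as T1.
  pose proof (Rabs_triang (c1 * ip (L x) z) (- (c2 * ip (L x) (J z)))) as T2.
  rewrite Rabs_Ropp in T1, T2. lra.
Qed.

(** The threshold [N] precedes the coefficients: all normalised combinations of [x_n] and [L x_n]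
    tend weakly to zero uniformly, so coefficients depending on [n] are permitted later. *)
Lemma admissible_small xs zs eta : admissible DL L xs -> 0 < eta ->
  exists N, forall n, (N <= n)%nat -> forall a1 a2 c1 c2,
    let y := comb a1 a2 c1 c2 (xs n) (L (xs n)) in abs_sum (ip y) zs <= eta * vnorm y.
Proof.
  intros Ad. pose proof Ad as (Hx & W1 & W2). revert eta.
  induction zs as [|z zs I]; intros eta He.
  - exists 0%nat. intros n _ a1 a2 c1 c2 y. simpl. pose proof (vnorm_ge0 y). nra.
  - destruct (I (eta / 2)) as [N0 HN0]; [lra|].
    (* The factor 4 of [comb_pairing] turns [eta / 8] into [eta / 2]; the rest of the list has the
       other half. *)
    assert (Ev : forall (u : nat -> H), (forall n, u n <> 0v) -> forall t,
               Un_cv (fun n => ip (u n) t / vnorm (u n)) 0 ->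
               exists N, forall n, (N <= n)%nat -> Rabs (ip (u n) t) <= eta / 8 * vnorm (u n)).
    { intros u Nu t Hu. destruct (Hu (eta / 8)) as [N HN]; [lra|]. exists N. intros n Hn.
      specialize (HN n Hn). unfold Rdist in HN. rewrite Rminus_0_r in HN.
      pose proof (vnorm_gt0 (u n) (Nu n)). unfold Rdiv in HN.
      rewrite Rabs_mult, Rabs_inv, (Rabs_pos_eq (vnorm _)) in HN by lra.
      apply Rmult_le_reg_r with (/ vnorm (u n)); [apply Rinv_0_lt_compat; auto|].
      rewrite (Rmult_assoc (eta / 8)), Rinv_r by lra. lra. }
    assert (Nx : forall n, xs n <> 0v) by (intro; apply Hx).
    assert (Nl : forall n, L (xs n) <> 0v) by (intro; apply L_nonzero; apply Hx).
    destruct (Ev _ Nx z (W1 z)) as [N1 H1]. destruct (Ev _ Nx (J z) (W1 (J z))) as [N2 H2].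
    destruct (Ev _ Nl z (W2 z)) as [N3 H3]. destruct (Ev _ Nl (J z) (W2 (J z))) as [N4 H4].
    exists (N0 + N1 + N2 + N3 + N4)%nat. intros n Hn a1 a2 c1 c2 y. simpl.
    specialize (HN0 n ltac:(lia) a1 a2 c1 c2). fold y in HN0. cbv zeta in HN0.
    pose proof (comb_pairing a1 a2 c1 c2 (xs n) z (eta / 8) (proj1 (Hx n)) ltac:(lra)
                  (H1 n ltac:(lia)) (H2 n ltac:(lia)) (H3 n ltac:(lia)) (H4 n ltac:(lia))) as B.
    fold y in B. lra.
Qed.

Lemma pair_matrix_det mu x : DL x -> x <> 0v ->
  0 < vnorm x /\ 0 < vnorm (L x) /\
  ip (shift A mu x) x = vnorm x ^ 2 * (mat_a A L x - mu) /\
  ip (shift A mu (L x)) (L x) = vnorm (L x) ^ 2 * (mat_d A L x - mu) /\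
  herm_det (A := A) mu x (L x) =
    vnorm x ^ 2 * vnorm (L x) ^ 2 * ((mat_a A L x - mu) * (mat_d A L x - mu) - mat_b2 A L x).
Proof.
  intros Hx Nx. pose proof (vnorm_gt0 x Nx) as x0.
  pose proof (vnorm_gt0 (L x) (L_nonzero x Hx Nx)) as l0.
  assert (E1 : ip (shift A mu x) x = vnorm x ^ 2 * (mat_a A L x - mu)).
  { unfold mat_a, shift. ips. rewrite <- !vnorm_sq. field. lra. }
  assert (E2 : ip (shift A mu (L x)) (L x) = vnorm (L x) ^ 2 * (mat_d A L x - mu)).
  { unfold mat_d, shift. ips. rewrite <- !vnorm_sq. field. lra. }
  repeat split; auto. unfold herm_det. rewrite E1, E2.
  assert (O : ip x (J (L x)) = 0) by (rewrite <- L_J; auto using pair_orthogonal, DL_J).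
  assert (E3 : ip (shift A mu x) (L x) = ip (A x) (L x)).
  { unfold shift. ips. rewrite (pair_orthogonal x x); auto. ring. }
  assert (E4 : ip (shift A mu x) (J (L x)) = ip (A x) (J (L x))).
  { unfold shift. ips. rewrite O. ring. }
  rewrite E3, E4. unfold mat_b2. field. lra.
Qed.

Lemma mat_b2_ge0 x : DL x -> x <> 0v -> 0 <= mat_b2 A L x.
Proof.
  intros Hx Nx. destruct (pair_matrix_det 0 x Hx Nx) as (x0 & l0 & _).
  unfold mat_b2. apply Rmult_le_pos; [nra|]. left. apply Rinv_0_lt_compat.
  apply Rmult_lt_0_compat; apply pow_lt; auto.
Qed.

Lemma mu_roots x : DL x -> x <> 0v ->
  herm_det (A := A) (mu1 A L x) x (L x) = 0 /\ herm_det (A := A) (mu2 A L x) x (L x) = 0 /\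
  mu1 A L x <= mat_a A L x /\ mu1 A L x <= mat_d A L x.
Proof.
  intros Hx Nx. pose proof (mat_b2_ge0 x Hx Nx) as b0.
  destruct (pair_matrix_det (mu1 A L x) x Hx Nx) as (_ & _ & _ & _ & ->).
  destruct (pair_matrix_det (mu2 A L x) x Hx Nx) as (_ & _ & _ & _ & ->).
  unfold mu1, mu2. set (a := mat_a A L x). set (d := mat_d A L x) in *. set (b := mat_b2 A L x) in *.
  pose proof (pow2_ge_0 ((a - d) / 2)) as q0.
  set (r := sqrt (((a - d) / 2) ^ 2 + b)).
  assert (Er : r ^ 2 = ((a - d) / 2) ^ 2 + b) by (apply pow2_sqrt; lra).
  assert (r0 : 0 <= r) by apply sqrt_pos.
  assert (K : Rabs ((a - d) / 2) <= r).
  { apply Rsqr_incr_0_var; auto. rewrite <- Rsqr_abs. unfold Rsqr. lra. }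
  pose proof (Rle_abs ((a - d) / 2)). pose proof (Rle_abs (- ((a - d) / 2))) as K'.
  rewrite Rabs_Ropp in K'.
  repeat split; try lra; nra.
Qed.

(** On the pair, [A - mu1] has zero determinant and nonnegative diagonal entries. *)
Lemma mu1_lower x a1 a2 c1 c2 : DL x -> x <> 0v ->
  let y := comb a1 a2 c1 c2 x (L x) in mu1 A L x * ip y y <= ip (A y) y.
Proof.
  intros Hx Nx y. destruct (mu_roots x Hx Nx) as (E & _ & I1 & I2).
  destruct (pair_matrix_det (mu1 A L x) x Hx Nx) as (x0 & l0 & E1 & E2 & _).
  assert (0 <= ip (shift A (mu1 A L x) y) y) as Q.
  { apply (herm_nonneg hA); auto using DL_dom, L_dom; [rewrite E1|rewrite E2|lra];
      apply Rmult_le_pos; nra. }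
  unfold shift in Q. autorewrite with ip in Q. lra.
Qed.

Lemma mu_attained mu x : DL x -> x <> 0v -> herm_det (A := A) mu x (L x) = 0 ->
  exists a1 a2 c1 c2, let y := comb a1 a2 c1 c2 x (L x) in
    D y /\ 0 < ip y y /\ ip (A y) y = mu * ip y y.
Proof.
  intros Hx Nx E.
  destruct (herm_kernel hA mu x (L x) (DL_dom x Hx) (L_dom x Hx) E) as (a1 & a2 & c1 & c2 & Nz & K).
  destruct (pair_matrix_det mu x Hx Nx) as (x0 & l0 & _).
  exists a1, a2, c1, c2. intro y. split; [|split].
  - apply (comb_dom hA); auto using DL_dom, L_dom.
  - unfold y. rewrite comb_norm, <- !vnorm_sq; auto.
    assert (0 < vnorm x ^ 2) by (apply pow_lt; auto).
    assert (0 < vnorm (L x) ^ 2) by (apply pow_lt; auto).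
    pose proof (pow2_ge_0 a1); pose proof (pow2_ge_0 a2).
    pose proof (pow2_ge_0 c1); pose proof (pow2_ge_0 c2).
    assert (Sq : forall t, t <> 0 -> 0 < t ^ 2) by (intros; nra).
    destruct Nz as [N|[N|[N|N]]]; apply Sq in N;
      [apply Rplus_lt_le_0_compat|apply Rplus_lt_le_0_compat
      |apply Rplus_le_lt_0_compat|apply Rplus_le_lt_0_compat]; nra.
  - specialize (K a1 a2 c1 c2). fold y in K. unfold shift in K. autorewrite with ip in K. lra.
Qed.

(** Infinitely many good indices suffice throughout, so no subsequence is extracted. *)
Definition frequently (p : nat -> Prop) : Prop := forall N, exists n, (N <= n)%nat /\ p n.

(** Orthogonality gives [<(A - lam) p, h> = <w, (A - lam) h>] on the generators, so [p] is
    determined by finitely many functionals of [w]. Taking [|p| + |(A - lam) p|] as the seminorm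
    bounds both factors of the form. *)
Lemma pair_projection_bound lam g : all_DL g -> ~ comp_eig (pair_span g) A lam ->
  exists C zs, 0 <= C /\ forall w p, D w -> pair_span g p ->
    (forall v, pair_span g v -> ip (shift A lam (w -v p)) v = 0) ->
    Rabs (ip (shift A lam p) p) <= C * abs_sum (ip w) zs ^ 2.
Proof.
  intros Hg Nc. pose proof (sa_subspace hA) as (D0 & Da & Ds).
  pose proof (real_gens_dom g Hg) as Hr.
  destruct (nondegenerate_bound D _ (shift_sym_form hA lam)
     (fun x => vnorm x + vnorm (shift A lam x)) (real_gens g) Hr) with (l := real_gens g)
     as (C & C0 & HC); auto.
  - rewrite (shift_zero hA), vnorm_zero. ring.
  - intros a x y Hx Hy. rewrite (shift_add hA), (shift_scal hA) by auto.
    pose proof (vnorm_triang (a *v x) y). pose proof (vnorm_triang (a *v shift A lam x) (shift A lam y)).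
    rewrite !vnorm_scal in *. lra.
  - intro x. pose proof (vnorm_ge0 x); pose proof (vnorm_ge0 (shift A lam x)); lra.
  - intros p Hp E. apply (pair_nondegenerate lam g Nc); [apply real_gens_span; auto|].
    intros u Hu. apply E, real_gens_span; auto.
  - exists (C ^ 2), (map (shift A lam) (real_gens g)). split; [apply pow2_ge_0|].
    intros w p Hw Hp O. assert (Dp : D p) by (apply (pair_span_dom g); auto).
    specialize (HC p (proj2 (real_gens_span g p Hg) Hp)).
    rewrite (abs_sum_ext _ (fun h => ip w (shift A lam h))) in HC.
    2:{ intros h Hh. rewrite <- (shift_sym hA) by auto.
        assert (O' := O h ltac:(apply real_gens_span; auto using rspan_mem)).
        rewrite (shift_sub hA) in O' by auto. autorewrite with ip in O'. lra. }
    rewrite abs_sum_map. set (s := abs_sum _ _) in *.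
    pose proof (cauchy_schwarz (shift A lam p) p) as CS.
    pose proof (vnorm_ge0 p). pose proof (vnorm_ge0 (shift A lam p)).
    assert (vnorm (shift A lam p) * vnorm p <= (C * s) * (C * s)) by (apply Rmult_le_compat; lra).
    lra.
Qed.

(** On [y - r] the form is that of [y] minus that of [r]: the first is at least
    [(lam' - lam) |y|^2], and the second is a smaller multiple of [|y|^2] once the index is large.
    The margin between [lam] and [lam'] pays for this error. *)
Lemma far_pair lam lam' xs g x : all_DL g -> DL x -> ~ comp_eig (pair_span g) A lam ->
  lam < lam' -> admissible DL L xs -> frequently (fun n => lam' < mu1 A L (xs n)) ->
  exists x', DL x' /\ ~ in_cspan (x :: g) x' /\
  forall p q, pair_span g p -> pair_span g q ->
     (forall v, pair_span g v -> ip (shift A lam (x' -v p)) v = 0) ->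
     (forall v, pair_span g v -> ip (shift A lam (L x' -v q)) v = 0) ->
     0 < ip (shift A lam (x' -v p)) (x' -v p) /\ 0 < herm_det (A := A) lam (x' -v p) (L x' -v q).
Proof.
  intros Hg Hx Nc Hl Ad Fr.
  destruct (pair_projection_bound lam g Hg Nc) as (C & zs & C0 & HC).
  assert (Hxg : all_DL (x :: g)) by (intros y [<-|Hy]; auto).
  destruct (rspan_pairing_bound (real_gens (x :: g))) as (C' & C0' & HC').
  set (eta := sqrt ((lam' - lam) / (C + 1))).
  assert (e0 : 0 < eta) by (apply sqrt_lt_R0, Rdiv_lt_0_compat; lra).
  assert (Ee : C * eta ^ 2 < lam' - lam).
  { unfold eta. rewrite pow2_sqrt by (left; apply Rdiv_lt_0_compat; lra).
    apply Rmult_lt_reg_r with (C + 1); [lra|].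
    replace (C * ((lam' - lam) / (C + 1)) * (C + 1)) with (C * (lam' - lam)) by (field; lra). nra. }
  destruct (admissible_small xs zs eta Ad e0) as [N1 HN1].
  (* This threshold keeps [x'] out of the span, where [|x'|^2 <= C' / (C' + 1) |x'|^2] would hold;
     the coefficients 1, 0, 0, 0 used below give [x'] itself. *)
  destruct (admissible_small xs (real_gens (x :: g)) (/ (C' + 1)) Ad) as [N2 HN2].
  { apply Rinv_0_lt_compat; lra. }
  destruct (Fr (N1 + N2)%nat) as (n & Hn & Hmu).
  specialize (HN1 n ltac:(lia)). specialize (HN2 n ltac:(lia) 1 0 0 0).
  destruct (proj1 Ad n) as [Dx' Nx']. set (x' := xs n) in *.
  exists x'. split; auto. split.
  - intro Cx. assert (Sx : rspan (real_gens (x :: g)) x') by (apply real_gens_span; auto using pair_span_cspan).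
    pose proof (HC' x' x' Sx) as B. cbv zeta in HN2.
    replace (comb 1 0 0 0 x' (L x')) with x' in HN2 by (unfold comb; vext).
    pose proof (vnorm_gt0 x' Nx') as P0.
    rewrite <- vnorm_sq, Rabs_pos_eq in B by nra.
    set (s := abs_sum _ _) in *.
    assert (C' * vnorm x' * s <= C' * vnorm x' * (/ (C' + 1) * vnorm x')).
    { apply Rmult_le_compat_l; auto. nra. }
    assert (C' * / (C' + 1) < 1).
    { apply Rmult_lt_reg_r with (C' + 1); [lra|]. rewrite Rmult_assoc, Rinv_l; lra. }
    assert (0 < vnorm x' ^ 2) by (apply pow_lt; auto). nra.
  - intros p q Hp Hq Op Oq.
    assert (Dp : D p) by (apply (pair_span_dom g); auto).
    assert (Dq : D q) by (apply (pair_span_dom g); auto).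
    pose proof (DL_dom x' Dx') as D1. pose proof (L_dom x' Dx') as D2.
    apply (herm_pos_det hA); try (apply (sa_dom_sub hA); auto).
    intros a1 a2 c1 c2 Nz. rewrite <- comb_sub.
    set (y := comb a1 a2 c1 c2 x' (L x')). set (r := comb a1 a2 c1 c2 p q).
    assert (Dy : D y) by (apply (comb_dom hA); auto).
    assert (Hr : pair_span g r) by (apply pair_span_comb; auto).
    assert (Dr : D r) by (apply (pair_span_dom g); auto).
    assert (Or : forall v, pair_span g v -> ip (shift A lam (y -v r)) v = 0).
    { intros v Hv. unfold y, r. rewrite comb_sub.
      apply (comb_orthogonal lam g); auto; apply (sa_dom_sub hA); auto. }
    pose proof (HC y r Dy Hr Or) as B. specialize (HN1 a1 a2 c1 c2). cbv zeta in HN1. fold y in HN1.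
    pose proof (mu1_lower x' a1 a2 c1 c2 Dx' Nx') as Lo. cbv zeta in Lo. fold y in Lo.
    (* The cross terms cancel because [y - r] is form-orthogonal to [r]. *)
    assert (E : ip (shift A lam (y -v r)) (y -v r) = ip (shift A lam y) y - ip (shift A lam r) r).
    { pose proof (Or r Hr) as O. rewrite (shift_sub hA) in * by auto. autorewrite with ip in *.
      assert (ip (shift A lam r) y = ip (shift A lam y) r) by (rewrite (shift_sym hA), hs_ip_sym; auto).
      lra. }
    rewrite E. unfold shift at 1. ips.
    assert (y0 : 0 < vnorm y).
    { apply vnorm_gt0. intro Z0.
      apply (comb_independent nil a1 a2 c1 c2 x'); auto; [intros ? []|].
      unfold y in Z0. rewrite Z0. apply pair_span_subspace. intros ? []. }
    rewrite <- vnorm_sq in *. set (s := abs_sum _ _) in *.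
    assert (s0 : 0 <= s) by apply abs_sum_ge0.
    pose proof (Rle_abs (ip (shift A lam r) r)).
    assert (0 < vnorm y ^ 2) by (apply pow_lt; auto).
    assert (s ^ 2 <= eta ^ 2 * vnorm y ^ 2) by nra.
    assert (C * s ^ 2 <= C * (eta ^ 2 * vnorm y ^ 2)) by (apply Rmult_le_compat_l; auto).
    assert (lam' * vnorm y ^ 2 <= mu1 A L x' * vnorm y ^ 2) by (apply Rmult_le_compat_r; lra).
    nra.
Qed.

(* A core vector [u + L v] is reached from [pair_span g] by adjoining [u] and then [v]; each step has
   a nonnegative Schur complement, so only the component in the fixed space [pair_span g] can make
   the form negative. *)
Lemma form_lower_bound lam lam' xs g : all_DL g ->
  (forall g', all_DL g' -> (forall u, in_cspan g u -> in_cspan g' u) ->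
     ~ comp_eig (pair_span g') A lam) ->
  lam < lam' -> admissible DL L xs -> frequently (fun n => lam' < mu1 A L (xs n)) ->
  exists C zs, 0 <= C /\ forall w, D w -> - (C * abs_sum (ip w) zs ^ 2) <= ip (shift A lam w) w.
Proof.
  intros Hg Hne Hl Ad Fr.
  (* The comparison vector is chosen afresh for each [g1] and [x], since how far along the sequence
     one must go depends on both. *)
  assert (Step : forall g1 x, all_DL g1 -> (forall u, in_cspan g u -> in_cspan g1 u) -> DL x ->
    forall w, pair_span (x :: g1) w -> exists p, pair_span g1 p /\
    (forall v, pair_span g1 v -> ip (shift A lam (w -v p)) v = 0) /\
    0 <= ip (shift A lam (w -v p)) (w -v p)).
  { intros g1 x Hg1 Sub Hx.
    destruct (far_pair lam lam' xs g1 x Hg1 Hx (Hne g1 Hg1 Sub) Hl Ad Fr) as (x' & Hx' & Nx' & Pos).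
    apply (schur_step lam g1 x x'); auto. }
  destruct (pair_projection_bound lam g Hg (Hne g Hg (fun _ h => h))) as (C & zs & C0 & HC).
  assert (Core : forall u v, DL u -> DL v ->
     - (C * abs_sum (ip (u +v L v)) zs ^ 2) <= ip (shift A lam (u +v L v)) (u +v L v)).
  { intros u v Hu Hv. set (w := u +v L v). set (g1 := u :: g). set (g2 := v :: g1).
    assert (Hg1 : all_DL g1) by (intros y [<-|Hy]; auto).
    assert (Hg2 : all_DL g2) by (intros y [<-|Hy]; auto).
    assert (Hw : pair_span g2 w).
    { exists u, v. repeat split; [apply cspan_cons_tail|]; apply cspan_cons_head. }
    destruct (Step g1 v Hg1 (cspan_cons_tail u g) Hv w Hw) as (p1 & Hp1 & O1 & P1).
    destruct (Step g u Hg (fun _ h => h) Hu p1 Hp1) as (p & Hp & O & P0).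
    assert (Dw : D w) by (apply (pair_span_dom g2); auto).
    assert (D1 : D p1) by (apply (pair_span_dom g1); auto).
    assert (Dp : D p) by (apply (pair_span_dom g); auto).
    assert (M : forall y, pair_span g y -> pair_span g1 y).
    { intro y. apply pair_span_mono, cspan_cons_tail. }
    (* Thus [p] is the form projection of [w] itself, and the error is measured by functionals of
       [w] with constants that depend on [g] alone, not on [u] and [v]. *)
    assert (Ow : forall y, pair_span g y -> ip (shift A lam (w -v p)) y = 0).
    { intros y Hy. replace (w -v p) with ((w -v p1) +v (p1 -v p)) by vext.
      rewrite (shift_add hA) by (apply (sa_dom_sub hA); auto). rewrite hs_ip_add, O1, O; auto; ring. }
    pose proof (HC w p Dw Hp Ow) as B. pose proof (Rle_abs (- ip (shift A lam p) p)) as B'.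
    rewrite Rabs_Ropp in B'.
    pose proof (O1 p1 Hp1) as E1. pose proof (O p Hp) as E2. pose proof (O1 p (M p Hp)) as E3.
    pose proof (shift_sym hA lam w p1 Dw D1) as S1. pose proof (shift_sym hA lam p1 p D1 Dp) as S2.
    rewrite (shift_sub hA) in * by auto. autorewrite with ip in *.
    rewrite (hs_ip_sym H (shift A lam w) p1) in *. rewrite (hs_ip_sym H (shift A lam p1) p) in *.
    rewrite (hs_ip_sym H (shift A lam w) w) in *. rewrite (hs_ip_sym H (shift A lam p1) p1) in *.
    rewrite (hs_ip_sym H p1 (shift A lam w)), (hs_ip_sym H p (shift A lam p1)) in *.
    rewrite (hs_ip_sym H w (shift A lam p1)), (hs_ip_sym H p1 (shift A lam p)) in *.
    lra. }
  exists C, zs. split; auto. intros w Hw.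
  set (S := abs_sum (fun z => vnorm z) zs). assert (S0 : 0 <= S) by apply abs_sum_ge0.
  set (s := abs_sum (ip w) zs). assert (s0 : 0 <= s) by apply abs_sum_ge0.
  set (t := vnorm (shift A lam w)). assert (t0 : 0 <= t) by apply vnorm_ge0.
  set (l1 := 1 + Rabs lam). assert (l0 : 0 <= l1) by (unfold l1; pose proof (Rabs_pos lam); lra).
  assert (Goal1 : - (C * s ^ 2) - ip (shift A lam w) w <= 0); [|lra].
  (* Both sides are continuous in the graph norm; the factor collects the changes caused by a
     perturbation of graph norm at most [eps <= 1]. *)
  apply (le_of_le_eps_mul _ (2 * t + l1 + C * (2 * s * S + S ^ 2))).
  { assert (0 <= s * S) by (apply Rmult_le_pos; auto). pose proof (pow2_ge_0 S).
    assert (0 <= C * (2 * s * S + S ^ 2)) by (apply Rmult_le_pos; lra). lra. }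
  intros eps0 He0. set (eps := Rmin eps0 1).
  assert (He : 0 < eps <= 1 /\ eps <= eps0).
  { unfold eps. pose proof (Rmin_l eps0 1). pose proof (Rmin_r eps0 1).
    unfold Rmin in *. destruct (Rle_dec eps0 1); lra. }
  apply Rle_trans with (eps * (2 * t + l1 + C * (2 * s * S + S ^ 2))).
  2:{ apply Rmult_le_compat_r; [|lra].
      assert (0 <= s * S) by (apply Rmult_le_pos; auto). pose proof (pow2_ge_0 S).
      assert (0 <= C * (2 * s * S + S ^ 2)) by (apply Rmult_le_pos; lra). lra. }
  destruct (proj2 hcore w Hw (eps ^ 2)) as (w' & (u & v & Hu & Hv & Ew) & Ed); [nra|].
  pose proof (Core u v Hu Hv) as Q. rewrite <- Ew in Q.
  assert (Dw' : D w').
  { rewrite Ew. apply (sa_subspace hA); [apply DL_dom|apply L_dom]; auto. }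
  set (e := w' -v w) in *.
  assert (De : D e) by (apply (sa_dom_sub hA); auto).
  rewrite <- (sa_sub hA) in Ed by auto. fold e in Ed.
  pose proof (vnorm_ge0 e) as n0. pose proof (vnorm_ge0 (A e)) as m0.
  assert (N1 : vnorm e <= eps) by nra. assert (N2 : vnorm (A e) <= eps) by nra.
  assert (Ew' : w' = w +v e) by (unfold e; vext).
  assert (Qe : ip (shift A lam w') w' <= ip (shift A lam w) w + 2 * t * eps + l1 * eps).
  { rewrite Ew', (shift_add hA) by auto. ips.
    rewrite (shift_sym hA lam e w), (hs_ip_sym H e (shift A lam w)) by auto.
    pose proof (cauchy_schwarz (shift A lam w) e) as c1. fold t in c1.
    pose proof (Rle_abs (ip (shift A lam w) e)).
    pose proof (cauchy_schwarz (shift A lam e) e) as c2.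
    pose proof (Rle_abs (ip (shift A lam e) e)).
    assert (c3 : vnorm (shift A lam e) <= l1 * eps).
    { unfold shift, l1. eapply Rle_trans; [apply vnorm_sub_le|]. rewrite vnorm_scal.
      pose proof (Rabs_pos lam). nra. }
    assert (t * vnorm e <= t * eps) by (apply Rmult_le_compat_l; lra).
    assert (vnorm (shift A lam e) * vnorm e <= (l1 * eps) * 1).
    { apply Rmult_le_compat; try lra. apply vnorm_ge0. }
    lra. }
  assert (Ss : abs_sum (ip w') zs <= s + eps * S).
  { rewrite (abs_sum_ext _ (fun z => ip w z + ip e z)).
    2:{ intros. rewrite Ew'. apply hs_ip_add. }
    eapply Rle_trans; [apply abs_sum_add|]. fold s. apply Rplus_le_compat_l.
    unfold S. clear - N1 n0. induction zs as [|z zs I]; simpl; [lra|].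
    pose proof (cauchy_schwarz e z). pose proof (vnorm_ge0 z).
    rewrite (Rabs_pos_eq (vnorm z)) by auto. nra. }
  pose proof (abs_sum_ge0 (ip w') zs) as s0'.
  assert (abs_sum (ip w') zs ^ 2 <= s ^ 2 + eps * (2 * s * S + S ^ 2)).
  { apply Rle_trans with ((s + eps * S) ^ 2); [apply pow_incr; lra|].
    assert (eps * eps * S ^ 2 <= eps * S ^ 2) by (apply Rmult_le_compat_r; [apply pow2_ge_0|nra]).
    nra. }
  assert (C * abs_sum (ip w') zs ^ 2 <= C * (s ^ 2 + eps * (2 * s * S + S ^ 2)))
    by (apply Rmult_le_compat_l; auto).
  lra.
Qed.


(** * Construction of spurious eigenvalues *)

(** For each triple [(i, j, k)] choose a core vector whose graph point is within [1 / (k + 1)] of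
    [(d i, d j)], if there is one, and zero otherwise. Countability allows an increasing sequence of
    finite-dimensional spaces to exhaust the graph. *)
Lemma countable_graph_core : exists e : nat -> H * H,
  (forall n, DL (fst (e n)) /\ DL (snd (e n))) /\
  forall y, D y -> forall eps, 0 < eps -> exists n,
    let w := fst (e n) +v L (snd (e n)) in
    vnorm (w -v y) ^ 2 + vnorm (A w -v A y) ^ 2 < eps.
Proof.
  destruct (hs_separable H) as [d Hd].
  set (close := fun (n : nat) (e : H * H) =>
    let (i, jk) := of_nat n in let (j, k) := of_nat jk in
    let w := fst e +v L (snd e) in
    vnorm (w -v d i) < / (INR k + 1) /\ vnorm (A w -v d j) < / (INR k + 1)).
  assert (Ch : forall n, exists e : H * H, (DL (fst e) /\ DL (snd e)) /\
            ((exists e', (DL (fst e') /\ DL (snd e')) /\ close n e') -> close n e)).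
  { intro n. destruct (classic (exists e', (DL (fst e') /\ DL (snd e')) /\ close n e')) as [(e & He & Ce)|N].
    - exists e. auto.
    - exists (0v, 0v). split; [split; apply DL_subspace|]. tauto. }
  apply functional_choice in Ch. destruct Ch as [e He]. exists e.
  split; [intro n; apply He|]. intros y Hy eps Heps.
  (* Each of the two distances will be at most [2 r] with [r < del], so the squares add up to less
     than [8 del^2 = eps]. *)
  set (del := sqrt (eps / 8)).
  assert (d0 : 0 < del) by (apply sqrt_lt_R0; lra).
  assert (Ed : del ^ 2 = eps / 8) by (apply pow2_sqrt; lra).
  destruct (inv_INR_lt del d0) as [k Hk]. specialize (Hk k (le_n k)).
  set (r := / (INR k + 1)) in *. assert (r0 : 0 < r) by apply inv_INR_pos.
  destruct (Hd y (r / 2)) as [i Hi]; [lra|]. destruct (Hd (A y) (r / 2)) as [j Hj]; [lra|].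
  destruct (proj2 hcore y Hy ((r / 2) ^ 2)) as (w & (u & v & Hu & Hv & Ew) & Hw); [apply pow_lt; lra|].
  pose proof (vnorm_ge0 (w -v y)) as n1. pose proof (vnorm_ge0 (A w -v A y)) as n2.
  assert (W1 : vnorm (w -v y) < r / 2) by nra. assert (W2 : vnorm (A w -v A y) < r / 2) by nra.
  set (n := to_nat (i, to_nat (j, k))).
  assert (Cn : close n (e n)).
  { apply He. exists (u, v). split; [auto|]. unfold close, n. rewrite !cancel_of_to. simpl.
    rewrite <- Ew. fold r.
    pose proof (vnorm_triang_sub w y (d i)) as T1. pose proof (vnorm_triang_sub (A w) (A y) (d j)) as T2.
    fold (vsub (d i) y) in Hi. fold (vnorm (d i -v y)) in Hi.
    fold (vsub (d j) (A y)) in Hj. fold (vnorm (d j -v A y)) in Hj.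
    rewrite (vnorm_sub_sym y) in T1. rewrite (vnorm_sub_sym (A y)) in T2. lra. }
  exists n. intro w'. unfold close, n in Cn. rewrite !cancel_of_to in Cn.
  fold n in Cn. fold w' in Cn. fold r in Cn. destruct Cn as [C1 C2].
  fold (vsub (d i) y) in Hi. fold (vnorm (d i -v y)) in Hi.
  fold (vsub (d j) (A y)) in Hj. fold (vnorm (d j -v A y)) in Hj.
  pose proof (vnorm_triang_sub w' (d i) y). pose proof (vnorm_triang_sub (A w') (d j) (A y)).
  pose proof (vnorm_ge0 (w' -v y)). pose proof (vnorm_ge0 (A w' -v A y)).
  assert (vnorm (w' -v y) ^ 2 <= (2 * r) ^ 2) by (apply pow_incr; lra).
  assert (vnorm (A w' -v A y) ^ 2 <= (2 * r) ^ 2) by (apply pow_incr; lra).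
  assert (r ^ 2 < del ^ 2) by nra. lra.
Qed.

Definition approx_compression_eig lam : Prop :=
  forall g eps, all_DL g -> 0 < eps -> exists g', all_DL g' /\
    (forall u, in_cspan g u -> in_cspan g' u) /\
    exists mu, comp_eig (pair_span g') A mu /\ Rabs (lam - mu) < eps.

(** Stage [n] adjoins the [n]-th pair of the countable core, then enlarges until the compression has
    an eigenvalue within [1 / (n + 1)] of [lam]. Density and convergence thus hold for the same
    sequence. *)
Lemma spurious_of_approx lam : approx_compression_eig lam -> in_resolvent D A lam ->
  spurious D A DL L lam.
Proof.
  intros Q HR. destruct countable_graph_core as (e & He & De).
  assert (Ch : forall s : nat * {g | all_DL g}, exists g' : {g | all_DL g},
     in_cspan (proj1_sig g') (fst (e (fst s))) /\ in_cspan (proj1_sig g') (snd (e (fst s))) /\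
     (forall u, in_cspan (proj1_sig (snd s)) u -> in_cspan (proj1_sig g') u) /\
     exists mu, comp_eig (pair_span (proj1_sig g')) A mu /\ Rabs (lam - mu) < / (INR (fst s) + 1)).
  { intros [n [g Hg]]. simpl. destruct (He n) as [H1 H2].
    destruct (Q (fst (e n) :: snd (e n) :: g) (/ (INR n + 1))) as (g' & Hg' & Sub & E).
    - intros y [<-|[<-|Hy]]; auto.
    - apply inv_INR_pos.
    - exists (exist _ g' Hg'). simpl.
      split; [|split; [|split; auto]]; intros; apply Sub;
        auto using cspan_cons_head, cspan_cons_tail. }
  apply functional_choice in Ch. destruct Ch as [F HF].
  assert (Hnil : all_DL nil) by (intros ? []).
  set (G := nat_rect (fun _ => {g | all_DL g}) (exist _ nil Hnil) (fun n s => F (n, s))).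
  assert (GS : forall n, G (S n) = F (n, G n)) by reflexivity.
  exists (fun n => proj1_sig (G n)). intro W.
  split; [intros n; apply (proj2_sig (G n))|].
  split; [intros n x; rewrite GS; apply (HF (n, G n))|].
  split; [|split; [|intro N; apply N; auto]].
  - intros y Hy eps Heps. destruct (De y Hy eps Heps) as [n Hn].
    exists (S n), (fst (e n) +v L (snd (e n))). split; auto.
    exists (fst (e n)), (snd (e n)). rewrite GS.
    destruct (HF (n, G n)) as (F1 & F2 & _). auto.
  - intros eps Heps. destruct (inv_INR_lt eps Heps) as [N HN].
    (* [G 0] is the empty list and carries no eigenvalue; the tolerance of stage [n] is met at index
       [S n]. *)
    exists (S N). intros [|n] Hn; [lia|].
    destruct (HF (n, G n)) as (_ & _ & _ & mu & E & B). exists mu. split.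
    + exact E.
    + specialize (HN n ltac:(lia)). simpl in B. lra.
Qed.

(** The negation excludes a whole neighbourhood of [lam]; only the point itself is kept, as a
    vanishing determinant yields exactly [lam]. *)
Lemma no_compression_eig lam : in_resolvent D A lam -> ~ spurious D A DL L lam ->
  exists g, all_DL g /\ forall g', all_DL g' -> (forall u, in_cspan g u -> in_cspan g' u) ->
     ~ comp_eig (pair_span g') A lam.
Proof.
  intros HR N. apply NNPP; intro M. apply N, spurious_of_approx; auto.
  intros g eps Hg He. apply NNPP; intro K. apply M. exists g. split; auto.
  intros g' Hg' Sub E. apply K. exists g'. repeat split; auto. exists lam. split; auto.
  rewrite Rminus_diag, Rabs_R0. auto.
Qed.

(** * Isolated points of finite multiplicity and the contradiction at a finite point *)

Lemma cspan_real_gens (ls : list H) : exists zs, forall x, in_cspan ls x -> rspan zs x.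
Proof.
  induction ls as [|h ls [zs I]].
  - exists nil. auto.
  - exists (h :: J h :: zs). intros x (a & b & y & Hy & ->). exists a, (b *v J h +v y).
    split; [exists b, y; auto|]. vext.
Qed.

Lemma isolated_finite_of_not_ess l : ~ in_ess_spectrum D A l ->
  exists eps zs, 0 < eps /\
    (forall mu, mu <> l -> Rabs (mu - l) < eps -> in_resolvent D A mu) /\
    (forall v, D v -> A v = l *v v -> rspan zs v).
Proof.
  intros N. destruct (classic (in_resolvent D A l)) as [R|NR].
  - destruct (resolvent_open hA l R) as (eps & He & HR). exists eps, nil.
    split; [auto|split; [auto|]]. intros v Hv E. apply (proj1 R); auto. rewrite E. apply vsub_self.
  - assert (M : (exists eps, 0 < eps /\ forall mu, in_spectrum D A mu -> Rabs (mu - l) < eps -> mu = l) /\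
       (exists ls : list H, forall v, D v -> A v = l *v v -> in_cspan ls v)).
    { apply NNPP; intro K. apply N. split; auto. }
    destruct M as [(eps & He & Iso) (ls & Hls)]. destruct (cspan_real_gens ls) as [zs Hzs].
    exists eps, zs. split; [auto|split; [|auto]]. intros mu Nmu Hmu. apply NNPP; intro K. auto.
Qed.

Lemma target_finite l :
  (forall c, c < l -> exists xs, admissible DL L xs /\ frequently (fun n => c < mu1 A L (xs n))) ->
  (forall c, l < c -> exists xs, admissible DL L xs /\ frequently (fun n => mu1 A L (xs n) < c)) ->
  in_target D A DL L (Fin l).
Proof.
  intros Hup Hlo. apply NNPP; intro N. apply not_or_and in N. destruct N as [N1 N2].
  apply isolated_finite_of_not_ess in N2. destruct N2 as (eps1 & zs0 & He1 & HR & Hker).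
  apply not_all_ex_not in N1. destruct N1 as [eps0 N1]. apply imply_to_and in N1.
  destruct N1 as [He0 N1].
  set (k := Rmin eps0 eps1 / 2).
  assert (Hk : 0 < k /\ 2 * k <= eps0 /\ 2 * k <= eps1).
  { unfold k. pose proof (Rmin_l eps0 eps1). pose proof (Rmin_r eps0 eps1).
    unfold Rmin in *. destruct (Rle_dec eps0 eps1); lra. }
  destruct Hk as (k0 & ke0 & ke1).
  assert (Gap : forall mu, mu <> l -> Rabs (mu - l) < 2 * k -> in_resolvent D A mu).
  { intros mu Nmu Hmu. apply HR; auto. lra. }
  destruct (isolated_finite_lower_bound hA l k zs0 k0 Gap Hker) as (C0 & C0p & Iso).
  (* The interval of radius [k] about [m] ends at [l], so [(A - m)^-1] exists with norm at most
     [1 / k] even if [l] is an eigenvalue. *)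
  set (m := l - k).
  assert (GapM : forall mu, Rabs (mu - m) < k -> in_resolvent D A mu).
  { intros mu Hmu. unfold m in Hmu. apply Rabs_def2 in Hmu. apply Gap; [lra|]. apply Rabs_def1; lra. }
  pose proof (resolvent_interval_bound hA m k k0 GapM) as Bm.
  assert (Ch : forall y, exists a, D a /\ shift A m a = y).
  { apply (GapM m). rewrite Rminus_diag, Rabs_R0; auto. }
  apply functional_choice in Ch. destruct Ch as [res HRf].
  (* The end of the proof compares [(k - tau) V^2 <= (tau + k / 16) Y^2] with [Y <= 2 V]; since
     [15/16 > 4/8], this is impossible for [V > 0]. *)
  set (tau := k / 16). set (lam := l - tau).
  assert (Rl : in_resolvent D A lam).
  { apply Gap; unfold lam, tau; [lra|]. apply Rabs_def1; lra. }
  destruct (no_compression_eig lam Rl) as (g & Hg & Hne).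
  { intro Sp. apply N1. exists lam. split; auto. unfold lam, tau. apply Rabs_def1; lra. }
  destruct (Hup (l - tau / 2)) as (xs1 & Ad1 & Fr1); [unfold tau; lra|].
  destruct (form_lower_bound lam (l - tau / 2) xs1 g Hg Hne) as (C1 & zs1 & C1p & Lb); auto.
  { unfold lam, tau. lra. }
  destruct (Hlo (l + tau)) as (xs & Ad & Fr); [unfold tau; lra|].
  (* The bound 1 gives [eta^2 <= eta], the second entry makes the kernel term in [Bv] at most
     [Y / 4], and the third makes the defect in [Lb] at most [k / 16 * Y^2]. *)
  set (eta := Rmin 1 (Rmin (/ (4 * (k * C0 + 1))) (k / (16 * (C1 + 1))))).
  assert (kC : 0 <= k * C0) by (apply Rmult_le_pos; lra).
  assert (p1 : 0 < / (4 * (k * C0 + 1))) by (apply Rinv_0_lt_compat; lra).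
  assert (p2 : 0 < k / (16 * (C1 + 1))) by (apply Rdiv_lt_0_compat; lra).
  assert (He : 0 < eta /\ eta <= 1 /\ k * C0 * eta <= 1 / 4 /\ C1 * eta <= k / 16).
  { assert (eta <= 1) by apply Rmin_l.
    assert (e1 : eta <= / (4 * (k * C0 + 1))) by (eapply Rle_trans; [apply Rmin_r|apply Rmin_l]).
    assert (e2 : eta <= k / (16 * (C1 + 1))) by (eapply Rle_trans; [apply Rmin_r|apply Rmin_r]).
    assert (0 < eta) by (unfold eta; repeat apply Rmin_glb_lt; lra).
    repeat split; auto.
    - apply Rmult_le_compat_l with (r := k * C0 + 1) in e1; [|lra].
      replace ((k * C0 + 1) * / (4 * (k * C0 + 1))) with (1 / 4) in e1 by (field; lra). nra.
    - apply Rmult_le_compat_l with (r := C1 + 1) in e2; [|lra].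
      replace ((C1 + 1) * (k / (16 * (C1 + 1)))) with (k / 16) in e2 by (field; lra). nra. }
  destruct He as (e0 & e1 & e2 & e3).
  (* Functionals of [v] and of [a = res y] are moved onto [y] by symmetry of the resolvent:
     [<v, z> = <y, z - k res z>] and [<a, z> = <y, res z>]. *)
  destruct (admissible_small xs (map (fun z => z -v k *v res z) zs1) eta Ad e0) as [M1 HM1].
  destruct (admissible_small xs (map res zs0) eta Ad e0) as [M2 HM2].
  destruct (Fr (M1 + M2)%nat) as (n & Hn & Hmu).
  destruct (proj1 Ad n) as [Dx Nx].
  destruct (mu_attained (mu1 A L (xs n)) (xs n) Dx Nx) as (a1 & a2 & c1 & c2 & Dy & y0 & Ey).
  { apply (mu_roots (xs n) Dx Nx). }
  specialize (HM1 n ltac:(lia) a1 a2 c1 c2). specialize (HM2 n ltac:(lia) a1 a2 c1 c2).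
  cbv zeta in HM1, HM2. set (y := comb a1 a2 c1 c2 (xs n) (L (xs n))) in *.
  destruct (HRf y) as [Da Ea]. set (a := res y) in *.
  set (v := y -v k *v a).
  assert (Rsym : forall z, ip a z = ip y (res z)).
  { intro z. destruct (HRf z) as [Dz Ez]. rewrite <- Ez at 1. rewrite <- (shift_sym hA), Ea; auto. }
  assert (Tv : shift A l a = v).
  { rewrite (shift_shift m), Ea. unfold v, m. vext. }
  pose proof (sa_subspace hA) as (D0 & Dadd & Ds).
  assert (Dv : D v) by (apply (sa_dom_sub hA); auto).
  rewrite abs_sum_map in HM1, HM2.
  assert (S1 : abs_sum (ip v) zs1 <= eta * vnorm y).
  { rewrite (abs_sum_ext _ (fun z => ip y (z -v k *v res z))); auto.
    intros z _. unfold v. ips. rewrite Rsym. ring. }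
  assert (S0 : abs_sum (ip a) zs0 <= eta * vnorm y).
  { rewrite (abs_sum_ext _ (fun z => ip y (res z))); auto. }
  assert (Y0 : 0 < vnorm y).
  { apply vnorm_gt0. intro Z. rewrite Z, ip_zero_l in y0. lra. }
  set (Y := vnorm y) in *. set (V := vnorm v).
  assert (V0 : 0 <= V) by apply vnorm_ge0.
  assert (Ay : k * vnorm a <= Y) by (unfold Y; rewrite <- Ea; auto).
  (* Here [Y <= V + k |a|], and [Iso] at [a] gives [k |a| <= V / 2 + Y / 4]. *)
  assert (Bv : Y / 2 <= V).
  { pose proof (Iso a Da) as I. rewrite Tv in I. fold V in I.
    assert (Y <= V + k * vnorm a).
    { unfold Y, V. replace y with (v +v k *v a) by (unfold v; vext).
      eapply Rle_trans; [apply vnorm_triang|]. rewrite vnorm_scal, (Rabs_pos_eq k); lra. }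
    assert (k * vnorm a <= k * (V / (2 * k) + C0 * (eta * Y))).
    { apply Rmult_le_compat_l; [lra|]. eapply Rle_trans; [exact I|].
      apply Rplus_le_compat_l, Rmult_le_compat_l; auto. }
    replace (k * (V / (2 * k) + C0 * (eta * Y))) with (V / 2 + (k * C0 * eta) * Y) in H1 by (field; lra).
    nra. }
  assert (Qy : ip (shift A l y) y <= tau * Y ^ 2).
  { unfold shift. ips. rewrite Ey. unfold Y. rewrite vnorm_sq. nra. }
  (* An exact identity, after which [k <y, a> <= |y|^2] follows from the norm bound on the
     resolvent. *)
  assert (Qv : ip (shift A l v) v <= tau * Y ^ 2 - k * V ^ 2).
  { assert (ip (shift A l v) v = ip (shift A l y) y - k * ip y y + k * (k * ip y a) - k * ip v v) as ->.
    { unfold v at 1. rewrite (shift_sub hA), (shift_scal hA), Tv by auto. ips.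
      replace (ip (shift A l y) v) with (ip (shift A l y) y - k * ip (shift A l y) a)
        by (unfold v; ips; ring).
      rewrite (shift_sym hA l y a), Tv by auto. unfold v at 1. ips. ring. }
    pose proof (cauchy_schwarz y a) as CS. fold Y in CS. pose proof (Rle_abs (ip y a)).
    pose proof (vnorm_ge0 a).
    assert (k * ip y a <= Y * Y) by nra.
    assert (k * (k * ip y a) <= k * (Y * Y)) by (apply Rmult_le_compat_l; lra).
    rewrite <- !vnorm_sq. fold Y V. lra. }
  pose proof (Lb v Dv) as B. rewrite (shift_shift l) in B. autorewrite with ip in B.
  rewrite <- vnorm_sq in B. fold V in B.
  replace (l - lam) with tau in B by (unfold lam; ring).
  assert (s0 : 0 <= abs_sum (ip v) zs1) by apply abs_sum_ge0.
  assert (abs_sum (ip v) zs1 ^ 2 <= (eta * Y) ^ 2) by (apply pow_incr; lra).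
  assert (C1 * abs_sum (ip v) zs1 ^ 2 <= C1 * (eta * Y) ^ 2) by (apply Rmult_le_compat_l; auto).
  assert (YY : 0 < Y ^ 2) by (apply pow_lt; auto).
  assert (C1 * (eta * Y) ^ 2 <= k / 16 * Y ^ 2).
  { replace (C1 * (eta * Y) ^ 2) with (C1 * eta * eta * Y ^ 2) by ring.
    apply Rmult_le_compat_r; [lra|].
    assert (0 <= C1 * eta) by (apply Rmult_le_pos; lra). nra. }
  assert (Y ^ 2 <= 4 * V ^ 2) by nra.
  assert ((k - tau) * Y ^ 2 <= (k - tau) * (4 * V ^ 2)).
  { apply Rmult_le_compat_l; auto. unfold tau. lra. }
  unfold tau in *. nra.
Qed.

(** Stated for any root [mu] of the determinant, so that it serves [mu1] of [A] and [mu2] of [-A]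
    alike. *)
Lemma target_PInf :
  (forall c, exists x mu, DL x /\ x <> 0v /\ herm_det (A := A) mu x (L x) = 0 /\ c < mu) ->
  in_target D A DL L PInf.
Proof.
  intros Hx. right. intro c. apply NNPP; intro N.
  assert (HR : forall mu, c < mu -> in_resolvent D A mu).
  { intros mu Hmu. apply NNPP; intro K. apply N. exists mu. auto. }
  destruct (Hx c) as (x & mu & Dx & Nx & E & Hc).
  destruct (mu_attained mu x Dx Nx E) as (a1 & a2 & c1 & c2 & Dy & y0 & Ey).
  pose proof (form_le_of_resolvent hA c HR _ Dy). nra.
Qed.

End BalancedPairs.

(** * Negation of the operator *)

Section Negation.
Context {H : HilbertSpace} {D : H -> Prop}.
Implicit Types (A B : H -> H).

(** A symmetric relation rather than a map, so each transfer lemma can be read in both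
    directions. *)
Definition opposite A B : Prop := forall x, B x = (-1) *v A x.

Lemma opposite_sym A B : opposite A B -> opposite B A.
Proof. intros E x. rewrite E. vext. Qed.

Lemma opposite_shift A B l x : opposite A B -> B x -v (- l) *v x = (-1) *v (A x -v l *v x).
Proof. intros E. rewrite E. vext. Qed.

Lemma self_adjoint_opposite A B : opposite A B -> self_adjoint D A -> self_adjoint D B.
Proof.
  intros E ((HD & Aa & As & AJ) & _ & Dn & _ & Sy & Mx).
  pose proof HD as (D0 & Da & Ds & DJ).
  split; [|split; [auto|split; [auto|split; [auto|split]]]].
  - split; [auto|split; [|split]]; intros; rewrite !E.
    + rewrite Aa; auto. vext.
    + rewrite As; auto. vext.
    + rewrite AJ; auto. vext.
  - intros x y Hx Hy. rewrite !E. ips. rewrite Sy; auto.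
  - intros y z _ _ Hyz. destruct (Mx y ((-1) *v z) I I) as [Dy Ay].
    + intros x Hx. specialize (Hyz x Hx). rewrite E in Hyz. autorewrite with ip in *. lra.
    + split; auto. rewrite E, Ay. vext.
Qed.

Lemma core_opposite A B S : opposite A B -> is_core D A S -> is_core D B S.
Proof.
  intros E [S1 S2]. split; auto. intros y Hy eps He.
  destruct (S2 y Hy eps He) as (w & Hw & Ew). exists w. split; auto.
  rewrite !E. replace ((-1) *v A w -v (-1) *v A y) with ((-1) *v (A w -v A y)) by vext.
  rewrite vnorm_scal, Rabs_left by lra. lra.
Qed.

Lemma resolvent_opposite A B l : opposite A B -> in_resolvent D A l -> in_resolvent D B (- l).
Proof.
  intros E (R1 & R2 & C & R3). split; [|split].
  - intros x Hx. rewrite (opposite_shift A B l); auto. intros Z. apply R1; auto.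
    apply (f_equal (hs_scal (-1))) in Z. rewrite hs_scal_assoc in Z.
    replace (-1 * -1) with 1 in Z by ring. rewrite hs_scal_one in Z. rewrite Z. vext.
  - intros y. destruct (R2 ((-1) *v y)) as (x & Hx & Ex). exists x. split; auto.
    rewrite (opposite_shift A B l), Ex; auto. vext.
  - exists C. intros x Hx. rewrite (opposite_shift A B l), vnorm_scal, Rabs_left by (auto; lra).
    specialize (R3 x Hx). lra.
Qed.

Lemma spectrum_opposite A B l : opposite A B -> in_spectrum D A l -> in_spectrum D B (- l).
Proof.
  intros E Sp R. apply Sp. rewrite <- (Ropp_involutive l).
  apply (resolvent_opposite B A); auto using opposite_sym.
Qed.

Lemma ess_spectrum_opposite A B l : opposite A B -> in_ess_spectrum D A l -> in_ess_spectrum D B (- l).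
Proof.
  intros E [Sp N]. split; [apply (spectrum_opposite A); auto|].
  intros [(eps & He & Iso) (ls & Hls)]. apply N. split.
  - exists eps. split; auto. intros mu Hmu Hd. apply (spectrum_opposite A B) in Hmu; auto.
    apply Iso in Hmu; [lra|]. replace (- mu - - l) with (- (mu - l)) by ring. now rewrite Rabs_Ropp.
  - exists ls. intros v Hv Ev. apply Hls; auto. rewrite E, Ev. vext.
Qed.

Lemma comp_eig_opposite A B V l : opposite A B -> comp_eig V A l -> comp_eig V B (- l).
Proof.
  intros E (v & Hv & Nv & O). exists v. repeat split; auto. intros w Hw.
  rewrite (opposite_shift A B l), hs_ip_scal, O; auto. ring.
Qed.

Lemma spurious_opposite A B DL L l : opposite A B -> spurious D A DL L l -> spurious D B DL L (- l).
Proof.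
  intros E (gens & G1 & G2 & G3 & G4 & G5). exists gens. intro W.
  split; [auto|split; [auto|split; [|split]]].
  - intros y Hy eps He. destruct (G3 y Hy eps He) as (n & w & Hw & Ew). exists n, w. split; auto.
    rewrite !E. replace ((-1) *v A w -v (-1) *v A y) with ((-1) *v (A w -v A y)) by vext.
    rewrite vnorm_scal, Rabs_left by lra. lra.
  - intros eps He. destruct (G4 eps He) as (N & HN). exists N. intros n Hn.
    destruct (HN n Hn) as (mu & Hmu & Em). exists (- mu). split.
    + apply (comp_eig_opposite A B); auto.
    + replace (- l - - mu) with (- (l - mu)) by ring. now rewrite Rabs_Ropp.
  - intros Sp. apply G5. rewrite <- (Ropp_involutive l).
    apply (spectrum_opposite B A); auto using opposite_sym.
Qed.

Definition Rbar_opp (l : Rbar) : Rbar :=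
  match l with Fin r => Fin (- r) | PInf => MInf | MInf => PInf end.

Lemma target_opposite A B DL L l : opposite A B ->
  in_target D A DL L (Rbar_opp l) -> in_target D B DL L l.
Proof.
  intros E. assert (SpB := fun s => spurious_opposite A B DL L s E).
  assert (SiB := fun s => spectrum_opposite A B s E).
  destruct l as [r| |]; simpl.
  - intros [T|T].
    + left. intros eps He. destruct (T eps He) as (s & Hs & Es). exists (- s). split; auto.
      replace (- s - r) with (- (s - - r)) by ring. now rewrite Rabs_Ropp.
    + right. rewrite <- (Ropp_involutive r). apply (ess_spectrum_opposite A); auto.
  - intros [T|T]; [left|right]; intro c; destruct (T (- c)) as (s & Hs & Es);
      exists (- s); split; auto; lra.
  - intros [T|T]; [left|right]; intro c; destruct (T (- c)) as (s & Hs & Es);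
      exists (- s); split; auto; lra.
Qed.

Lemma mu_opposite A B L x : opposite A B -> mu1 B L x = - mu2 A L x /\ mu2 B L x = - mu1 A L x.
Proof.
  intros E. assert (mat_a B L x = - mat_a A L x) as Ea.
  { unfold mat_a. rewrite E. ips. unfold Rdiv. ring. }
  assert (mat_d B L x = - mat_d A L x) as Ed.
  { unfold mat_d. rewrite E. ips. unfold Rdiv. ring. }
  assert (mat_b2 B L x = mat_b2 A L x) as Eb.
  { unfold mat_b2. rewrite E. ips. unfold Rdiv. ring. }
  unfold mu1, mu2. rewrite Ea, Ed, Eb.
  replace (((- mat_a A L x - - mat_d A L x) / 2) ^ 2) with (((mat_a A L x - mat_d A L x) / 2) ^ 2)
    by field.
  split; field.
Qed.

End Negation.

(** * Extended-real limits *)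

(** Otherwise a tail is bounded by [c]; its supremum is then a real number at most [c] and one of
    the values whose infimum is the limsup. *)
Lemma frequently_above_of_limsup (u : nat -> R) y c : is_limsup u y -> ~ Rbar_le y (Fin c) ->
  frequently (fun n => c < u n).
Proof.
  intros [Hlb _] N. apply NNPP; intro M. apply N.
  apply not_all_ex_not in M. destruct M as [N0 M].
  assert (Hu : forall n, (N0 <= n)%nat -> u n <= c).
  { intros n Hn. apply Rnot_lt_le; intro K. apply M. eauto. }
  destruct (completeness (fun t => exists n, (N0 <= n)%nat /\ t = u n)) as [b [Ub Lub]].
  - exists c. intros t (n & Hn & ->). auto.
  - exists (u N0), N0. auto.
  - assert (Hb : b <= c) by (apply Lub; intros t (n & Hn & ->); auto).
    assert (Hy : Rbar_le y (Fin b)).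
    { apply Hlb. exists N0. split.
      - intros z (n & Hn & ->). simpl. apply Ub. eauto.
      - intros [m| |] Hm; simpl; auto.
        + apply Lub. intros t (n & Hn & ->). apply (Hm (Fin (u n))). eauto.
        + apply (Hm (Fin (u N0))). eauto. }
    destruct y; simpl in *; auto. lra.
Qed.

Lemma frequently_below_of_liminf (u : nat -> R) y c : is_liminf u y -> ~ Rbar_le (Fin c) y ->
  frequently (fun n => u n < c).
Proof.
  intros [Hub _] N. apply NNPP; intro M. apply N.
  apply not_all_ex_not in M. destruct M as [N0 M].
  assert (Hu : forall n, (N0 <= n)%nat -> c <= u n).
  { intros n Hn. apply Rnot_lt_le; intro K. apply M. eauto. }
  destruct (completeness (fun t => exists n, (N0 <= n)%nat /\ t = - u n)) as [b [Ub Lub]].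
  - exists (- c). intros t (n & Hn & ->). specialize (Hu n Hn). lra.
  - exists (- u N0), N0. auto.
  - assert (Hb : b <= - c) by (apply Lub; intros t (n & Hn & ->); specialize (Hu n Hn); lra).
    assert (Hy : Rbar_le (Fin (- b)) y).
    { apply Hub. exists N0. split.
      - intros z (n & Hn & ->). simpl. assert (- u n <= b) by (apply Ub; eauto). lra.
      - intros [m| |] Hm; simpl; auto.
        + assert (b <= - m); [|lra]. apply Lub. intros t (n & Hn & ->).
          assert (m <= u n) by (apply (Hm (Fin (u n))); eauto). lra.
        + apply (Hm (Fin (u N0))). eauto. }
    destruct y; simpl in *; auto. lra.
Qed.

Lemma sup_limsup_frequently {T} (Ad : (nat -> T) -> Prop) (f : T -> R) M l c :
  Rbar_is_lub (fun y => exists xs, Ad xs /\ is_limsup (fun n => f (xs n)) y) M ->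
  Rbar_le l M -> ~ Rbar_le l (Fin c) -> exists xs, Ad xs /\ frequently (fun n => c < f (xs n)).
Proof.
  intros [_ Hlub] Hl Nl. apply NNPP; intro K. apply Nl.
  assert (HM : Rbar_le M (Fin c)).
  { apply Hlub. intros y (xs & Hxs & Hy). apply NNPP; intro N. apply K.
    exists xs. split; auto. apply (frequently_above_of_limsup _ y); auto. }
  destruct l, M; simpl in *; try tauto. lra.
Qed.

Lemma inf_liminf_frequently {T} (Ad : (nat -> T) -> Prop) (f : T -> R) m l c :
  Rbar_is_glb (fun y => exists xs, Ad xs /\ is_liminf (fun n => f (xs n)) y) m ->
  Rbar_le m l -> ~ Rbar_le (Fin c) l -> exists xs, Ad xs /\ frequently (fun n => f (xs n) < c).
Proof.
  intros [_ Hglb] Hl Nl. apply NNPP; intro K. apply Nl.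
  assert (Hm : Rbar_le (Fin c) m).
  { apply Hglb. intros y (xs & Hxs & Hy). apply NNPP; intro N. apply K.
    exists xs. split; auto. apply (frequently_below_of_liminf _ y); auto. }
  destruct l, m; simpl in *; try tauto. lra.
Qed.

Lemma frequently_imp (p q : nat -> Prop) : (forall n, p n -> q n) -> frequently p -> frequently q.
Proof. intros Hpq Hp N. destruct (Hp N) as (n & Hn & Pn). eauto. Qed.

Lemma target_of_mu1 {H : HilbertSpace} {D : H -> Prop} {A P : H -> H} {DL : H -> Prop} {L : H -> H}
  (hA : self_adjoint D A) (hP : orth_proj P) (hL : lin_op DL L)
  (hLP : forall x, DL x -> P x = x) (hLQ : forall x, DL x -> P (L x) = 0v)
  (hLinj : forall x y, DL x -> DL y -> L x = L y -> x = y)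
  (hcore : is_core D A (fun w => exists u v, DL u /\ DL v /\ w = hs_add u (L v))) l :
  (forall c, ~ Rbar_le l (Fin c) ->
     exists xs, admissible DL L xs /\ frequently (fun n => c < mu1 A L (xs n))) ->
  (forall c, ~ Rbar_le (Fin c) l ->
     exists xs, admissible DL L xs /\ frequently (fun n => mu1 A L (xs n) < c)) ->
  in_target D A DL L l.
Proof.
  intros Hup Hlo. destruct l as [r| |].
  - apply (target_finite hA hP hL hLP hLQ hLinj hcore).
    + intros c Hc. apply Hup. simpl. lra.
    + intros c Hc. apply Hlo. simpl. lra.
  - apply (target_PInf hA hP hL hLP hLQ hLinj hcore). intro c.
    destruct (Hup c) as (xs & Ad & Fr); [simpl; auto|]. destruct (Fr 0%nat) as (n & _ & Hn).
    destruct (proj1 Ad n) as [Dx Nx]. exists (xs n), (mu1 A L (xs n)). repeat split; auto.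
    apply (mu_roots hP hL hLP hLQ hLinj (xs n) Dx Nx).
  (* For [-A] the values [mu2], being the negatives of [mu1] of [A], are unbounded above. *)
  - set (B := fun x => (-1) *v A x).
    assert (E : opposite A B) by (intro; reflexivity).
    apply (target_opposite B A); [apply opposite_sym; auto|]. simpl.
    apply (target_PInf (self_adjoint_opposite A B E hA) hP hL hLP hLQ hLinj (core_opposite A B _ E hcore)).
    intro c. destruct (Hlo (- c)) as (xs & Ad & Fr); [simpl; auto|].
    destruct (Fr 0%nat) as (n & _ & Hn).
    destruct (proj1 Ad n) as [Dx Nx]. exists (xs n), (mu2 B L (xs n)).
    split; [auto|split; [auto|split]].
    + apply (mu_roots hP hL hLP hLQ hLinj (xs n) Dx Nx).
    + rewrite (proj2 (mu_opposite A B L (xs n) E)). lra.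
Qed.

Theorem mainTheorem12 (H : HilbertSpace) (DA : H -> Prop) (A : H -> H)
  (P : H -> H) (DL : H -> Prop) (L : H -> H)
  (hA : self_adjoint DA A)
  (hP : orth_proj P)
  (hL : lin_op DL L)
  (hLP : forall x, DL x -> P x = x)
  (hLQ : forall x, DL x -> P (L x) = hs_zero)
  (hLinj : forall x y, DL x -> DL y -> L x = L y -> x = y)
  (hcore : is_core DA A (fun w => exists u v, DL u /\ DL v /\ w = hs_add u (L v)))
  (hPAP : ess_sa_in (fun x => P x = x) DL (fun x => P (A x)))
  (hQAQ : ess_sa_in (fun x => P x = hs_zero) (fun w => exists v, DL v /\ w = L v)
                    (fun w => vsub (A w) (P (A w))))
  (m1 M1 m2 M2 : Rbar)
  (hm1 : Rbar_is_glb (fun y => exists xs, admissible DL L xs /\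
                   is_liminf (fun n => mu1 A L (xs n)) y) m1)
  (hM1 : Rbar_is_lub (fun y => exists xs, admissible DL L xs /\
                   is_limsup (fun n => mu1 A L (xs n)) y) M1)
  (hm2 : Rbar_is_glb (fun y => exists xs, admissible DL L xs /\
                   is_liminf (fun n => mu2 A L (xs n)) y) m2)
  (hM2 : Rbar_is_lub (fun y => exists xs, admissible DL L xs /\
                   is_limsup (fun n => mu2 A L (xs n)) y) M2)
  (l : Rbar)
  (hl : (Rbar_le m1 l /\ Rbar_le l M1) \/ (Rbar_le m2 l /\ Rbar_le l M2)) :
  in_target DA A DL L l.
Proof.
  destruct hl as [[l1 l2]|[l1 l2]].
  - apply (target_of_mu1 hA hP hL hLP hLQ hLinj hcore); intros c Hc.
    + exact (sup_limsup_frequently _ (mu1 A L) M1 l c hM1 l2 Hc).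
    + exact (inf_liminf_frequently _ (mu1 A L) m1 l c hm1 l1 Hc).
  - set (B := fun x => (-1) *v A x).
    assert (E : opposite A B) by (intro; reflexivity).
    apply (target_opposite B A); [apply opposite_sym; auto|].
    apply (target_of_mu1 (self_adjoint_opposite A B E hA) hP hL hLP hLQ hLinj
             (core_opposite A B _ E hcore)); intros c Hc.
    (* Negation exchanges the two ends: large values of [mu1] for [B] are small values of [mu2] for
       [A], so they come from [m2]. *)
    + destruct (inf_liminf_frequently _ (mu2 A L) m2 l (- c) hm2 l1) as (xs & Ad & Fr).
      { intro K. apply Hc. destruct l; simpl in *; auto. lra. }
      exists xs. split; auto. revert Fr. apply frequently_imp. intros n Hn.
      rewrite (proj1 (mu_opposite A B L (xs n) E)). lra.
    + destruct (sup_limsup_frequently _ (mu2 A L) M2 l (- c) hM2 l2) as (xs & Ad & Fr).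
      { intro K. apply Hc. destruct l; simpl in *; auto. lra. }
      exists xs. split; auto. revert Fr. apply frequently_imp. intros n Hn.
      rewrite (proj1 (mu_opposite A B L (xs n) E)). lra.
Qed.
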